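(* Let $\rho^{A_1\ldots A_m}$ be an $m$-partite quantum state. Then $$D(\rho)\ \ge\ \max_{G=([m],\mathsf{E})\ \text{spanning tree}}\Big(\sum_{\{i,j\}\in \mathsf{E}}\frac1{E_A(i:j|\rho)}\Big)^{-1},$$ where the maximum is over all spanning trees $G$ on vertex set $[m]$ with edge set $\mathsf{E}$ (with the convention that the bracketed expression is $0$ if some $E_A(i:j|\rho)=0$ for an edge of $G$).
   Context: $[m]=\{1,\ldots,m\}$. For parties $i\ne j$, the (asymptotic) entanglement of assistance $E_A(i:j|\rho)$ is the supremum of achievable rates of EPR pairs $|\Phi\rangle=\frac1{\sqrt2}(|00\rangle+|11\rangle)$ shared between parties $i$ and $j$ that can be distilled with vanishing infidelity from $\rho^{\otimes n}$ as $n\to\infty$ by LOCC among all $m$ parties (the other parties assisting). GHZ distillation capacity: let $|\Gamma_m\rangle=\frac1{\sqrt2}(|0\rangle^{\otimes m}+|1\rangle^{\otimes m})$. An $(n,\varepsilon)$-protocol of rate $k/n$ is an $m$-partite channel $\Lambda$ on $A_1^n\ldots A_m^n$ implementable by local operations and classical communication (LOCC) with $F(|\Gamma_m\rangle\langle\Gamma_m|^{\otimes k},\Lambda(\rho^{\otimes n}))\ge1-\varepsilon$, where $F(\rho,\sigma)=\|\sqrt\rho\sqrt\sigma\|_1$ is the fidelity and the $i$-th qubit of each GHZ state is held by party $i$. $R$ is achievable if for every $n$ there are $(n,\varepsilon_n)$-protocols with $\varepsilon_n\to0$ and $k/n\to R$; $D(\rho)=\sup\{R:R\text{ achievable}\}$.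 *)

(* Defs.v *)
From HB Require Import structures.
From mathcomp Require Import all_boot all_order all_algebra.
From mathcomp Require Import all_classical all_reals all_analysis.
From mathcomp Require Import complex.
From Stdlib Require ClassicalEpsilon.

Set Implicit Arguments.
Unset Strict Implicit.
Unset Printing Implicit Defensive.

Import Order.TTheory GRing.Theory Num.Theory.
Import numFieldNormedType.Exports.
Local Open Scope ring_scope.
Local Open Scope classical_set_scope.

(* Operators on a finite-dimensional Hilbert space with orthonormal basis   *)
(* indexed by a finType T are functions T -> T -> C (matrix entries).       *)
Section Quantum.
Variable R : realType.
Local Notation C := (R[i]).

Definition op (T : finType) := T -> T -> C.

Definition opmul (T : finType) (A B : op T) : op T :=
  fun x z => \sum_(y : T) A x y * B y z.
Definition adj (T : finType) (A : op T) : op T := fun x y => Num.conj (A y x).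
Definition trace (T : finType) (A : op T) : C := \sum_(x : T) A x x.

Definition psd (T : finType) (A : op T) : Prop :=
  forall v : T -> C, 0 <= \sum_(x : T) \sum_(y : T) Num.conj (v x) * A x y * v y.

Definition density (T : finType) (A : op T) : Prop := psd A /\ trace A = 1.

(* the (unique) positive semidefinite square root *)
Definition msqrt (T : finType) (A : op T) : op T :=
  ClassicalEpsilon.epsilon (inhabits (fun _ _ => 0 : C))
    (fun B => psd B /\ opmul B B = A).

Definition trnorm (T : finType) (X : op T) : R :=
  complex.Re (trace (msqrt (opmul (adj X) X))).

Definition fidelity (T : finType) (rho sigma : op T) : R :=
  trnorm (opmul (msqrt rho) (msqrt sigma)).

Definition ketbra (T : finType) (v : T -> C) : op T := fun x y => v x * Num.conj (v y).

(* m parties; party i has local system with basis L i.                      *)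
Variable m : nat.

Definition Joint (L : 'I_m -> finType) : finType := {dffun forall i : 'I_m, L i}.

Definition upd (L : 'I_m -> finType) (p : 'I_m) (T : finType) : 'I_m -> finType :=
  fun i => if i == p then T else L i.

Definition get_new (L : 'I_m -> finType) (p : 'I_m) (T : finType)
    (y : Joint (upd L p T)) : option T :=
  (match p == p as b return Finite.sort (if b then T else L p) -> option T with
   | true => fun z => Some z
   | false => fun _ => None
   end) (y p).

Definition cmp_old (L : 'I_m -> finType) (p : 'I_m) (T : finType) (i : 'I_m) :
    Finite.sort (upd L p T i) -> Finite.sort (L i) -> bool :=
  match i == p as b return Finite.sort (if b then T else L i) -> Finite.sort (L i) -> bool with
  | true => fun _ _ => true
  | false => fun a c => a == c
  end.

(* entry <y| K (x) Id_{others} |x> of the operator K : L p -> T acting on party p *)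
Definition liftK (L : 'I_m -> finType) (p : 'I_m) (T : finType) (K : T -> L p -> C)
    (y : Joint (upd L p T)) (x : Joint L) : C :=
  (if get_new y is Some t then K t (x p) else 0)
  * ([forall i, (i != p) ==> cmp_old (y i) (x i)])%:R.

Definition conj_by (T U : finType) (M : U -> T -> C) (rho : op T) : op U :=
  fun y y' => \sum_(x : T) \sum_(x' : T) M y x * rho x x' * Num.conj (M y' x').

(* local relabelling of basis states (a local permutation unitary) *)
Definition relabel (L L' : 'I_m -> finType) (f : forall i, L' i -> L i)
    (y : Joint L') : Joint L := [ffun i => f i (y i)].

(* Finite-round LOCC channels from parties' systems L to parties' systems L'.
   A protocol is a finite tree: at each node some party p performs a local
   quantum instrument (Kraus operators K x, x in the finite outcome set X,
   from its system L p to a new system T, with sum_x K_x^dagger K_x = 1),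
   broadcasts the outcome x, and the parties continue with a protocol
   depending on x.  (Coarse-grained instruments are covered because the
   continuation may ignore part of the outcome.)  Leaves are local
   relabellings of bases. *)
Inductive LOCC : forall L L' : 'I_m -> finType, (op (Joint L) -> op (Joint L')) -> Prop :=
| LOCC_relabel (L L' : 'I_m -> finType) (f : forall i, L' i -> L i) :
    (forall i, bijective (f i)) ->
    LOCC (fun rho y y' => rho (relabel f y) (relabel f y'))
| LOCC_step (L L' : 'I_m -> finType) (p : 'I_m) (T X : finType)
    (K : X -> T -> L p -> C)
    (Lam : X -> op (Joint (upd L p T)) -> op (Joint L')) :
    (forall a b : L p,
        \sum_(x : X) \sum_(t : T) Num.conj (K x t a) * K x t b = (a == b)%:R) ->
    (forall x, @LOCC (upd L p T) L' (Lam x)) ->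
    LOCC (fun rho y y' => \sum_(x : X) Lam x (conj_by (@liftK L p T (K x)) rho) y y').

Definition Lcopies (L : 'I_m -> finType) (n : nat) : 'I_m -> finType :=
  fun i => ({ffun 'I_n -> L i} : finType).

Definition slice (L : 'I_m -> finType) (n : nat) (x : Joint (Lcopies L n)) (t : 'I_n) :
  Joint L := [ffun i => (x i : {ffun 'I_n -> L i}) t].

Definition tensor_pow (L : 'I_m -> finType) (rho : op (Joint L)) (n : nat) :
  op (Joint (Lcopies L n)) :=
  fun x y => \prod_(t < n) rho (slice x t) (slice y t).

Definition Qk (k : nat) : finType := {ffun 'I_k -> bool}.
Definition Lqubits (k : nat) : 'I_m -> finType := fun _ => Qk k.

(* |Gamma_m>^{(x) k}, the i-th qubit of each GHZ state held by party i *)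
Definition ghz_ket (k : nat) (z : Joint (Lqubits k)) : C :=
  \prod_(t < k)
    (if [forall i, forall j, (z i : Qk k) t == (z j : Qk k) t]
     then (sqrtC 2)^-1 else 0).
Definition ghz_state (k : nat) : op (Joint (Lqubits k)) := ketbra (@ghz_ket k).

Definition Q2 (k : nat) : finType := (Qk k * Qk k)%type.

(* |Phi>^{(x) k} on (qubits of party i) x (qubits of party j) *)
Definition epr_ket (k : nat) (ab : Q2 k) : C :=
  \prod_(t < k) (if ab.1 t == ab.2 t then (sqrtC 2)^-1 else 0).
Definition epr_state (k : nat) : op (Q2 k) := ketbra (@epr_ket k).

(* reduced state of parties i and j (partial trace over all other parties) *)
Definition reduce2 (k : nat) (i j : 'I_m) (sigma : op (Joint (Lqubits k))) :
  op (Q2 k) :=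
  fun ab ab' => \sum_(z : Joint (Lqubits k)) \sum_(z' : Joint (Lqubits k))
    ([&& z i == ab.1, z j == ab.2, z' i == ab'.1, z' j == ab'.2 &
        [forall l, ((l != i) && (l != j)) ==> (z l == z' l)]])%:R * sigma z z'.

Definition achievable (prot : nat -> nat -> R -> Prop) (r : R) : Prop :=
  exists (k : nat -> nat) (eps : nat -> R),
    (forall n, prot n (k n) (eps n)) /\
    eps @ \oo --> (0 : R) /\
    (fun n => (k n)%:R / n%:R) @ \oo --> r.

Definition ghz_protocol (L : 'I_m -> finType) (rho : op (Joint L))
    (n k : nat) (eps : R) : Prop :=
  exists Lam : op (Joint (Lcopies L n)) -> op (Joint (Lqubits k)),
    LOCC Lam /\ 1 - eps <= fidelity (@ghz_state k) (Lam (@tensor_pow L rho n)).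

Definition ghz_capacity (L : 'I_m -> finType) (rho : op (Joint L)) : \bar R :=
  ereal_sup [set r%:E | r in achievable (ghz_protocol rho)].

(* EPR distillation between parties i and j, all parties assisting by LOCC;
   the systems of the other parties are traced out at the end *)
Definition epr_protocol (L : 'I_m -> finType) (rho : op (Joint L)) (i j : 'I_m)
    (n k : nat) (eps : R) : Prop :=
  exists Lam : op (Joint (Lcopies L n)) -> op (Joint (Lqubits k)),
    LOCC Lam /\
    1 - eps <= fidelity (@epr_state k) (reduce2 i j (Lam (@tensor_pow L rho n))).

Definition ent_assist (L : 'I_m -> finType) (rho : op (Joint L)) (i j : 'I_m) : \bar R :=
  ereal_sup [set r%:E | r in achievable (epr_protocol rho i j)].

(* Spanning trees on [m]: an edge {i,j} is encoded as the pair (i,j), i<j.   *)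
(* A spanning tree is a connected edge set in which every edge is a bridge   *)
(* (i.e. a connected acyclic spanning subgraph).                             *)
Definition adjE (E : {set 'I_m * 'I_m}) : rel 'I_m :=
  fun u v => ((u, v) \in E) || ((v, u) \in E).

Definition is_spanning_tree (E : {set 'I_m * 'I_m}) : bool :=
  [&& [forall e in E, (nat_of_ord e.1 < nat_of_ord e.2)%N],
      [forall u, forall v, connect (adjE E) u v] &
      [forall e in E, ~~ connect (adjE (E :\ e)) e.1 e.2]].

Definition einv (x : \bar R) : \bar R :=
  if x == 0%E then +oo%E else if x == +oo%E then 0%E else ((fine x)^-1)%:E.

(* ( sum_{ {i,j} in E } 1 / E_A(i:j|rho) )^{-1}, which is 0 when some
   E_A(i:j|rho) = 0 on an edge *)
Definition tree_value (L : 'I_m -> finType) (rho : op (Joint L))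
    (E : {set 'I_m * 'I_m}) : \bar R :=
  einv (\sum_(e in E) einv (ent_assist rho e.1 e.2))%E.

End Quantum.

(* Main.v *)
(* Fix rates q_e < E_A(e) on the edges of the tree and r with r * sum_e 1/q_e < 1,
   and distil about r n EPR pairs on every edge e from its own block of about
   (r / q_e) n copies.  The EPR pairs are fused into GHZ states by adding the
   tree edges one at a time: if the parties of S share GHZ states and i in S, j
   not in S share EPR pairs, one local measurement by i and one correction by j
   extend the GHZ states to j.  The squared fidelity with the target is at least
   the product of the squared fidelities on the edges, hence tends to 1.

   For a pure target f, F(f f^*, s)^2 = <f|s|f>, so fidelities are computed as
   expectation values, which are linear in s and multiplicative on product
   states. *)

Require Import Defs.
From HB Require Import structures.
From mathcomp Require Import all_boot all_order all_algebra.
From mathcomp Require Import all_classical all_reals all_analysis.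
From mathcomp Require Import complex.
From mathcomp Require Import ring lra.
From Stdlib Require ClassicalEpsilon.

Set Implicit Arguments.
Unset Strict Implicit.
Unset Printing Implicit Defensive.

Import Order.TTheory GRing.Theory Num.Theory.
Import numFieldNormedType.Exports.
Local Open Scope ring_scope.
Local Open Scope classical_set_scope.

(** * Positive semidefinite operators and fidelity with a pure state *)

Section LinearAlgebra.
Variable R : realType.
Local Notation C := (R[i]).

(** Monotonicity of the fidelity under channels is not invoked. Every overlap is 2^-k times a sum of
    matrix entries over pairs of basis states that satisfy the target condition and agree on a key,
    the key recording what is traced out. The fusion measurement and the discarding of registers
    merely compute in the basis and broadcast a value, so they re-index such a sum, possibly
    enlarging its key. Fusion thus becomes a comparison of two sums for one and the same product
    operator.

    [LOCC] has no primitive for discarding, and its systems change type through [upd]. Leftover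
    systems are therefore carried along as local remainders until the end, where each party measures
    its remainder and forgets the outcome. *)

Definition sform (T : finType) (A : op R T) (u v : T -> C) : C :=
  \sum_(x : T) \sum_(y : T) Num.conj (u x) * A x y * v y.

Lemma sform_comb (T : finType) (A : op R T) (u v : T -> C) (c : C) :
  sform A (fun x => u x + c * v x) (fun x => u x + c * v x) =
  sform A u u + c * sform A u v + Num.conj c * sform A v u
  + Num.conj c * c * sform A v v.
Proof.
rewrite /sform !mulr_sumr -!big_split; apply: eq_bigr => x _ /=.
rewrite !mulr_sumr -!big_split; apply: eq_bigr => y _ /=.
by rewrite rmorphD rmorphM /=; ring.
Qed.

Lemma sum_pick (T : finType) (x : T) (F : T -> C) :
  \sum_z (z == x)%:R * F z = F x.
Proof.
rewrite (bigD1 x) //= eqxx mul1r big1 ?addr0 // => z /negPf ->.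
by rewrite mul0r.
Qed.

Lemma sum_pickr (T : finType) (x : T) (F : T -> C) :
  \sum_z F z * (z == x)%:R = F x.
Proof. by rewrite -[RHS](sum_pick x F); apply: eq_bigr => z _; rewrite mulrC. Qed.

Lemma sform_delta (T : finType) (A : op R T) (x y : T) :
  sform A (fun z => (z == x)%:R) (fun z => (z == y)%:R) = A x y.
Proof.
rewrite /sform -[RHS](sum_pick x (fun z => A z y)); apply: eq_bigr => z _.
by rewrite sum_pickr conjC_nat.
Qed.

Lemma psd_sform (T : finType) (A : op R T) u : psd A -> 0 <= sform A u u.
Proof. by move=> /(_ u). Qed.

(** Positivity makes every [sform A w w] real. Testing the basis vectors at x and y, their sum, and
    the sum with a factor 'i on the second determines conj (A y x). *)
Lemma psd_herm (T : finType) (A : op R T) : psd A ->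
  forall x y, Num.conj (A y x) = A x y.
Proof.
move=> pA x y.
pose u z : C := (z == x)%:R; pose v z : C := (z == y)%:R.
have re w : Num.conj (sform A w w) = sform A w w.
  by apply/CrealP/ger0_real/psd_sform.
have := re (fun z => u z + 1 * v z); have := re (fun z => u z + 'i * v z).
have := re u; have := re v; rewrite !sform_comb !sform_delta !rmorphD !rmorphM /=.
move=> -> ->; rewrite conjCi rmorphN /= conjCi rmorph1 !mul1r opprK !mulNr.
rewrite rmorph1 !mul1r mulrN => e1 e2.
have {}e1 : Num.conj (A y x) - Num.conj (A x y) = A x y - A y x.
  apply: (mulfI (neq0Ci C)); rewrite !mulrBr.
  by apply: (addrI (A x x)); apply: (addIr (- ('i * 'i * A y y))); rewrite !addrA -e1; ring.
have {}e2 : Num.conj (A x y) + Num.conj (A y x) = A x y + A y x.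
  by apply: (addrI (A x x)); apply: (addIr (A y y)); rewrite !addrA -e2; ring.
have : Num.conj (A y x) *+ 2 = A x y *+ 2.
  have -> : Num.conj (A y x) *+ 2 = (Num.conj (A y x) - Num.conj (A x y)) +
    (Num.conj (A x y) + Num.conj (A y x)) by ring.
  by rewrite e1 e2; ring.
by move/eqP; rewrite eqr_pMn2r // => /eqP.
Qed.

Lemma sform_gram (T U : finType) (s : U -> C) (M : U -> T -> C) (v : T -> C) :
  sform (fun x y => \sum_k s k * Num.conj (M k x) * M k y) v v =
  \sum_k s k * `|\sum_x M k x * v x| ^+ 2.
Proof.
rewrite /sform.
under eq_bigr => x _ do under eq_bigr => y _ do rewrite mulr_sumr mulr_suml.
under eq_bigr => x _ do rewrite exchange_big /=.
rewrite exchange_big /=; apply: eq_bigr => k _.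
rewrite normCK mulrA rmorph_sum /= mulr_sumr.
apply: eq_bigr => x _; rewrite mulr_sumr mulr_suml; apply: eq_bigr => y _.
by rewrite rmorphM /=; ring.
Qed.


Lemma psd_gram (T U : finType) (s : U -> C) (M : U -> T -> C) :
  (forall k, 0 <= s k) ->
  psd (fun x y => \sum_k s k * Num.conj (M k x) * M k y).
Proof.
move=> s0 v; have := @sform_gram T U s M v; rewrite /sform => ->.
by apply: sumr_ge0 => k _; rewrite mulr_ge0 ?exprn_ge0.
Qed.

Lemma psd_spectral (T : finType) (A : op R T) : psd A ->
  exists (s : T -> C) (M : T -> T -> C), [/\ forall k, 0 <= s k,
   forall k l, \sum_x M k x * Num.conj (M l x) = (k == l)%:R &
   A = fun x y => \sum_k s k * Num.conj (M k x) * M k y].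
Proof.
move=> pA; pose n := #|T|.
pose B : 'M[C]_n := \matrix_(i, j) A (enum_val i) (enum_val j).
have hB : B \is hermsymmx.
  apply/is_hermitianmxP; rewrite expr0 scale1r; apply/matrixP => i j.
  by rewrite !mxE psd_herm.
have /orthomx_spectralP := hermitian_normalmx hB.
have uP := spectral_unitarymx B; rewrite invmx_unitary //.
move: (spectralmx B) uP (spectral_diag B) => P /unitarymxP uP d eB.
pose M (k x : T) := P (enum_rank k) (enum_rank x).
have orth k l : \sum_x M k x * Num.conj (M l x) = (k == l)%:R.
  have /matrixP/(_ (enum_rank k) (enum_rank l)) := uP.
  rewrite !mxE (inj_eq enum_rank_inj) => <-.
  rewrite (reindex (@enum_rank T)) /=; last first.
    by exists enum_val => i _; rewrite ?enum_rankK ?enum_valK.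
  by apply: eq_bigr => x _; rewrite !mxE /M.
have eA : A = fun x y => \sum_k d 0 (enum_rank k) * Num.conj (M k x) * M k y.
  apply/funext => x; apply/funext => y.
  have /matrixP/(_ (enum_rank x) (enum_rank y)) := eB.
  rewrite !mxE !enum_rankK => ->.
  rewrite (reindex (@enum_rank T)) /=; last first.
    by exists enum_val => i _; rewrite ?enum_rankK ?enum_valK.
  apply: eq_bigr => k _; congr (_ * _).
  rewrite mxE (bigD1 (enum_rank k)) //= big1 ?addr0; last first.
    by move=> j /negPf nj; rewrite !mxE nj mulr0n mulr0.
  by rewrite !mxE eqxx mulr1n mulrC.
exists (fun k => d 0 (enum_rank k)), M; split => // k.
(* The conjugated row k is an eigenvector, so the form evaluated there is the k-th eigenvalue. *)
have := pA (fun x => Num.conj (M k x)).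
have -> : \sum_x \sum_y Num.conj (Num.conj (M k x)) * A x y * Num.conj (M k y) =
  \sum_l d 0 (enum_rank l) * `|\sum_x M l x * Num.conj (M k x)| ^+ 2.
  rewrite {1}eA; exact: (sform_gram (fun l => d 0 (enum_rank l)) M (fun x => Num.conj (M k x))).
rewrite (bigD1 k) //= orth eqxx normr1 expr1n mulr1 big1 ?addr0 // => l nl.
by rewrite orth (negPf nl) normr0 expr0n mulr0.
Qed.

Lemma psd_sqrt (T : finType) (A : op R T) : psd A ->
  exists B, psd B /\ opmul B B = A.
Proof.
move=> /psd_spectral [s [M [s0 orth ->]]].
exists (fun x y => \sum_k sqrtC (s k) * Num.conj (M k x) * M k y); split.
  by apply: psd_gram => k; rewrite sqrtC_ge0.
apply/funext => x; apply/funext => z; rewrite /opmul.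
under eq_bigr => y _ do rewrite mulr_suml.
rewrite exchange_big /=; apply: eq_bigr => k _.
under eq_bigr => y _ do rewrite mulr_sumr.
rewrite exchange_big /=.
transitivity (\sum_j (sqrtC (s k) * Num.conj (M k x) * sqrtC (s j) * M j z) * (j == k)%:R).
  apply: eq_bigr => j _; rewrite eq_sym -orth mulr_sumr; apply: eq_bigr => y _.
  by ring.
by rewrite sum_pickr -[in RHS](sqrtCK (s k)); ring.
Qed.

Lemma msqrtP (T : finType) (A : op R T) : psd A ->
  psd (msqrt A) /\ opmul (msqrt A) (msqrt A) = A.
Proof. by move=> /psd_sqrt; apply: ClassicalEpsilon.epsilon_spec. Qed.

Lemma herm_sq0 (T : finType) (B : op R T) :
  (forall x y, Num.conj (B y x) = B x y) ->
  (forall x, opmul B B x x = 0) -> forall x y, B x y = 0.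
Proof.
move=> hB B0 x y; have := B0 x; rewrite /opmul.
under eq_bigr => z _ do rewrite -(hB z x) -normCK.
move=> /eqP; rewrite psumr_eq0 => [/allP/(_ y)|z _]; last exact: exprn_ge0.
by rewrite mem_index_enum implyTb => /(_ isT); rewrite expf_eq0 /= normr_eq0 => /eqP.
Qed.

Definition vnorm2 (T : finType) (v : T -> C) : C := \sum_x `|v x| ^+ 2.

Lemma vnorm2_ge0 (T : finType) (v : T -> C) : 0 <= vnorm2 v.
Proof. by apply: sumr_ge0 => x _; apply: exprn_ge0. Qed.

Lemma psd_ketbra (T : finType) (v : T -> C) : psd (ketbra v).
Proof.
have := @psd_gram T 'I_1 (fun=> 1) (fun=> fun x => Num.conj (v x)) (fun=> ler01).
by congr psd; apply/funext => x; apply/funext => y; rewrite big_ord1 /ketbra conjCK mul1r.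
Qed.

(** [msqrt] is only a chosen root, so its value on a rank-one operator has to be derived. B v = l v
    with l >= 0, and B^2 v = |v|^2 v forces l = |v|. The difference D of B and the expected root
    then squares to 0, and a Hermitian D with this property vanishes. *)
Lemma sqrt_ketbra (T : finType) (v : T -> C) (B : op R T) :
  psd B -> opmul B B = ketbra v ->
  forall x y, B x y = ketbra v x y / sqrtC (vnorm2 v).
Proof.
move=> pB eB; have hB := psd_herm pB.
have eBxy x z : \sum_y B x y * B y z = v x * Num.conj (v z).
  by have := congr1 (fun f => f x z) eB.
have [v0|v0] := eqVneq (vnorm2 v) 0.
  move=> x y; rewrite /ketbra.
  have vx z : v z = 0.
    move/eqP: v0; rewrite psumr_eq0 => [/allP/(_ z)|? _]; last exact: exprn_ge0.
    by rewrite mem_index_enum implyTb => /(_ isT); rewrite expf_eq0 /= normr_eq0 => /eqP.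
  rewrite vx !mul0r; apply: herm_sq0 => // z.
  by rewrite /opmul eBxy vx mul0r.
pose s : C := sqrtC (vnorm2 v).
have s_gt0 : 0 < s by rewrite sqrtC_gt0 lt_def v0 vnorm2_ge0.
have s0 : s != 0 by rewrite gt_eqF.
have ss : s ^+ 2 = vnorm2 v by rewrite sqrtCK.
pose w x := \sum_y B x y * v y.
have vv : \sum_y Num.conj (v y) * v y = vnorm2 v.
  by apply: eq_bigr => y _; rewrite normCK mulrC.
(* B commutes with B^2, so B v is a multiple of v. *)
have comm x z : w x * Num.conj (v z) = v x * Num.conj (w z).
  transitivity (\sum_a \sum_b B x a * B a b * B b z).
    rewrite /w mulr_suml; apply: eq_bigr => a _.
    rewrite -mulrA -eBxy mulr_sumr; apply: eq_bigr => b _; by rewrite mulrA.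
  rewrite exchange_big /= /w rmorph_sum mulr_sumr; apply: eq_bigr => b _.
  rewrite -mulr_suml eBxy rmorphM /= hB; by ring.
pose l := (\sum_y Num.conj (v y) * w y) / vnorm2 v.
have wl x : w x = l * v x.
  have : \sum_z (w x * Num.conj (v z)) * v z = \sum_z v x * Num.conj (w z) * v z.
    by apply: eq_bigr => z _; rewrite comm.
  under eq_bigr => z _ do rewrite -mulrA.
  rewrite -mulr_sumr vv => e.
  have e2 : \sum_z v x * Num.conj (w z) * v z = v x * Num.conj (\sum_y Num.conj (v y) * w y).
    by rewrite rmorph_sum mulr_sumr; apply: eq_bigr => z _; rewrite rmorphM /= conjCK; ring.
  have lr : Num.conj (\sum_y Num.conj (v y) * w y) = \sum_y Num.conj (v y) * w y.
    apply/CrealP/ger0_real; have := pB v; congr (0 <= _); apply: eq_bigr => y _.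
    by rewrite /w mulr_sumr; apply: eq_bigr => z _; rewrite mulrA.
  apply: (mulIf v0); rewrite e e2 lr /l; field.
  exact: v0.
have l0 : 0 <= l.
  rewrite /l mulr_ge0 ?invr_ge0 ?vnorm2_ge0 //.
  have := pB v; congr (0 <= _); apply: eq_bigr => y _.
  by rewrite /w mulr_sumr; apply: eq_bigr => z _; rewrite mulrA.
have ls : l = s.
  have [x vx] : exists x, v x != 0.
    apply/existsP; apply: contraNT v0; rewrite negb_exists => /forallP h.
    apply/eqP; apply: big1 => x _; have := h x; rewrite negbK => /eqP ->.
    by rewrite normr0 expr0n.
  have : \sum_y B x y * w y = vnorm2 v * v x.
    transitivity (\sum_y \sum_z B x y * B y z * v z).
      by apply: eq_bigr => y _; rewrite /w mulr_sumr; apply: eq_bigr => z _; rewrite mulrA.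
    rewrite exchange_big /= -vv mulr_suml; apply: eq_bigr => z _.
    by rewrite -mulr_suml eBxy; ring.
  under eq_bigr => y _ do rewrite wl mulrCA.
  rewrite -mulr_sumr -/(w x) wl mulrA -ss => /(mulIf vx) /eqP.
  by rewrite -expr2 eqrXn2 ?(ltW s_gt0) // => /eqP.
pose D : op R T := fun x y => B x y - v x * Num.conj (v y) / s.
have sr : Num.conj s = s by apply/CrealP/ger0_real/ltW.
have hD x y : Num.conj (D y x) = D x y.
  have srV : Num.conj s^-1 = s^-1 by rewrite fmorphV /= sr.
  by rewrite /D rmorphB !rmorphM /= srV conjCK hB; congr (_ - _ * _); rewrite mulrC.
have D0 x : opmul D D x x = 0.
  rewrite /opmul /D.
  transitivity (\sum_y (B x y * B y x - (B x y * v y) * (Num.conj (v x) / s)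
     - (v x / s) * Num.conj (B x y * v y)
     + (v x * Num.conj (v x) / s ^+ 2) * (Num.conj (v y) * v y))).
    apply: eq_bigr => y _; rewrite rmorphM /= hB; field. exact: s0.
  rewrite !big_split /= !sumrN -!mulr_sumr -mulr_suml eBxy -/(w x).
  rewrite -rmorph_sum -/(w x) wl ls rmorphM /= sr vv -ss; field. exact: s0.
move=> x y; have /eqP := herm_sq0 hD D0 x y; rewrite subr_eq0 => /eqP ->.
by rewrite /ketbra.
Qed.

Lemma psd_conj_form (T : finType) (S : op R T) (f : T -> C) : psd S ->
  vnorm2 (fun x => \sum_y S x y * f y) = sform (opmul S S) f f.
Proof.
move=> pS; have hS := psd_herm pS; rewrite /vnorm2 /sform.
transitivity (\sum_z \sum_x \sum_y Num.conj (f x) * (S x z * S z y) * f y).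
  apply: eq_bigr => z _; rewrite normCK mulrC rmorph_sum mulr_suml.
  apply: eq_bigr => x _; rewrite mulr_sumr; apply: eq_bigr => y _.
  by rewrite rmorphM /= hS; ring.
rewrite exchange_big /=; apply: eq_bigr => x _; rewrite exchange_big /=.
by apply: eq_bigr => y _; rewrite /opmul mulr_sumr mulr_suml.
Qed.

(** With S the root of [sigma] and w = S f, the product of roots is |f><w|. Its trace norm is |w|,
    because X^dagger X = |w><w|, and |w|^2 = <f|S^2|f>. *)
Lemma fidelity_pure (T : finType) (f : T -> C) (sigma : op R T) :
  vnorm2 f = 1 -> psd sigma ->
  0 <= fidelity (ketbra f) sigma /\
  ((fidelity (ketbra f) sigma) ^+ 2)%:C%C = sform sigma f f.
Proof.
move=> f1 ps; have [pS eS] := msqrtP ps; set S := msqrt sigma in pS eS.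
have hS := psd_herm pS.
have [pF eF] := msqrtP (psd_ketbra f).
have F x y : msqrt (ketbra f) x y = f x * Num.conj (f y).
  by rewrite (sqrt_ketbra pF eF) f1 sqrtC1 divr1.
pose w x := \sum_y S x y * f y.
have X x z : opmul (msqrt (ketbra f)) S x z = f x * Num.conj (w z).
  rewrite /opmul /w rmorph_sum mulr_sumr; apply: eq_bigr => y _.
  by rewrite F rmorphM /= hS; ring.
have XX : opmul (adj (opmul (msqrt (ketbra f)) S)) (opmul (msqrt (ketbra f)) S) = ketbra w.
  apply/funext => x; apply/funext => z; rewrite /ketbra {1}/opmul /adj.
  transitivity (\sum_y (w x * Num.conj (w z)) * `|f y| ^+ 2).
    by apply: eq_bigr => y _; rewrite !X rmorphM /= conjCK normCK; ring.
  by rewrite -mulr_sumr -/(vnorm2 f) f1 mulr1.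
have [pW eW] := msqrtP (psd_ketbra w).
have tr : trace (msqrt (ketbra w)) = sqrtC (vnorm2 w).
  rewrite /trace; under eq_bigr => x _ do rewrite (sqrt_ketbra pW eW) /ketbra -normCK.
  rewrite -mulr_suml -/(vnorm2 w).
  have [->|n0] := eqVneq (vnorm2 w) 0; first by rewrite sqrtC0 mul0r.
  apply: (mulIf (x := sqrtC (vnorm2 w))); first by rewrite sqrtC_eq0.
  by rewrite divfK ?sqrtC_eq0 // -expr2 sqrtCK.
have tr0 : 0 <= sqrtC (vnorm2 w) by rewrite sqrtC_ge0 vnorm2_ge0.
have fid : (fidelity (ketbra f) sigma)%:C%C = sqrtC (vnorm2 w).
  by rewrite /fidelity /trnorm -/S XX tr RRe_real ?ger0_real.
split; first by rewrite -lecR fid.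
by rewrite rmorphXn /= fid sqrtCK /w psd_conj_form // eS.
Qed.

End LinearAlgebra.

(** * Closure properties of LOCC *)

Section LOCCTheory.
Variables (R : realType) (m : nat).
Local Notation C := (R[i]).
Implicit Types (L M A B J : 'I_m -> finType) (p : 'I_m).

Lemma relabel_bij L L' (f : forall i, L' i -> L i) :
  (forall i, bijective (f i)) -> bijective (relabel f).
Proof.
move=> fb; pose g i y := [pick x | f i x == y].
have gK i x : g i (f i x) = Some x.
  rewrite /g; case: pickP => [z /eqP /(bij_inj (fb i)) -> //|/(_ x)].
  by rewrite eqxx.
apply: inj_card_bij.
  move=> x y e; apply/ffunP => i; apply: (bij_inj (fb i)).
  by have /ffunP/(_ i) := e; rewrite !ffunE.
rewrite !card_dep_ffun; apply/eq_leq; congr (foldr _ _ _).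
by apply: eq_codom => i; rewrite (bij_eq_card (fb i)).
Qed.

Lemma psd_relabel (T U : finType) (F : U -> T) (rho : op R T) :
  bijective F -> psd rho -> psd (fun y y' => rho (F y) (F y')).
Proof.
case=> G FG GF pr v; have := pr (v \o G); congr (0 <= _).
have bF : bijective F by exists G.
rewrite (reindex F) /=; last exact: onW_bij.
apply: eq_bigr => x _; rewrite (reindex F) /=; last exact: onW_bij.
by apply: eq_bigr => y _; rewrite !FG.
Qed.

Lemma psd_conj_by (T U : finType) (M : U -> T -> C) (rho : op R T) :
  psd rho -> psd (conj_by M rho).
Proof.
move=> pr v; have := pr (fun x => \sum_y Num.conj (M y x) * v y); congr (0 <= _).
transitivity (\sum_x \sum_x' \sum_y \sum_y'
   (M y x * rho x x' * Num.conj (M y' x')) * (Num.conj (v y) * v y')).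
  apply: eq_bigr => x _; apply: eq_bigr => x' _.
  rewrite rmorph_sum mulr_suml mulr_suml; apply: eq_bigr => y _.
  rewrite mulr_sumr; apply: eq_bigr => y' _.
  by rewrite rmorphM /= conjCK; ring.
under eq_bigr => x _ do rewrite exchange_big /=.
rewrite exchange_big /=; apply: eq_bigr => y _.
under eq_bigr => x _ do rewrite exchange_big /=.
rewrite exchange_big /=; apply: eq_bigr => y' _.
rewrite /conj_by mulr_sumr mulr_suml; apply: eq_bigr => x _.
by rewrite mulr_sumr mulr_suml; apply: eq_bigr => x' _; ring.
Qed.

Lemma psd_sum (T X : finType) (rho : X -> op R T) :
  (forall x, psd (rho x)) -> psd (fun y y' => \sum_x rho x y y').
Proof.
move=> pr v.
have : 0 <= \sum_x sform (rho x) v v by apply: sumr_ge0 => x _; apply: pr.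
congr (0 <= _); rewrite /sform exchange_big /=; apply: eq_bigr => y _.
rewrite exchange_big /=; apply: eq_bigr => z _.
by rewrite mulr_sumr mulr_suml.
Qed.

Lemma LOCC_psd L L' (Lam : op R (Joint L) -> op R (Joint L')) (rho : op R (Joint L)) :
  LOCC Lam -> psd rho -> psd (Lam rho).
Proof.
move=> lo; elim: lo rho => {L L' Lam} [L L' f fb|L L' p T X K Lam _ _ IH] rho pr.
  exact/psd_relabel/pr/relabel_bij.
by apply: psd_sum => x; apply/IH/psd_conj_by.
Qed.

Lemma conj_by_sum (T U X : finType) (M : U -> T -> C) (c : X -> C) (rho : X -> op R T) :
  conj_by M (fun x x' => \sum_a c a * rho a x x') =
  fun y y' => \sum_a c a * conj_by M (rho a) y y'.
Proof.
apply/funext => y; apply/funext => y'; rewrite /conj_by.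
under [RHS]eq_bigr => a _ do rewrite mulr_sumr.
rewrite [RHS]exchange_big /=; apply: eq_bigr => x _.
under [RHS]eq_bigr => a _ do rewrite mulr_sumr.
rewrite [RHS]exchange_big /=; apply: eq_bigr => x' _.
by rewrite mulr_sumr mulr_suml; apply: eq_bigr => a _; ring.
Qed.

(** [LOCC] is a predicate on arbitrary maps of operators, so linearity comes from induction on the
    protocol tree. It lets a later protocol pass through a sum over outcomes. *)
Lemma LOCC_sum L L' (Lam : op R (Joint L) -> op R (Joint L')) (X : finType)
    (c : X -> C) (rho : X -> op R (Joint L)) : LOCC Lam ->
  Lam (fun x x' => \sum_a c a * rho a x x') = fun y y' => \sum_a c a * Lam (rho a) y y'.
Proof.
move=> lo; elim: lo rho => {L L' Lam} [L L' f fb|L L' p T Y K Lam _ _ IH] rho //.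
apply/funext => y; apply/funext => y'.
under eq_bigr => x _ do rewrite conj_by_sum IH.
by rewrite exchange_big /=; apply: eq_bigr => a _; rewrite mulr_sumr.
Qed.

Lemma LOCC_scale L L' (Lam : op R (Joint L) -> op R (Joint L')) (c : C) rho :
  LOCC Lam -> Lam (fun x x' => c * rho x x') = fun y y' => c * Lam rho y y'.
Proof.
move=> lo; have := @LOCC_sum L L' Lam 'I_1 (fun=> c) (fun=> rho) lo.
have -> T (f : op R T) : (fun x x' => \sum_(a < 1) c * f x x') = fun x x' => c * f x x'.
  by apply/funext => x; apply/funext => x'; rewrite big_ord1.
by move=> ->; apply/funext => y; apply/funext => y'; rewrite big_ord1.
Qed.

Lemma LOCC_add L L' (Lam : op R (Joint L) -> op R (Joint L')) (X : finType) rho :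
  LOCC Lam -> Lam (fun x x' => \sum_(a : X) rho a x x') = fun y y' => \sum_a Lam (rho a) y y'.
Proof.
move=> lo; have := @LOCC_sum L L' Lam X (fun=> 1) rho lo.
have e T (f : X -> op R T) : (fun x x' => \sum_a 1 * f a x x') = fun x x' => \sum_a f a x x'.
  by apply/funext => x; apply/funext => x'; apply: eq_bigr => a _; rewrite mul1r.
by rewrite (e _ rho) (e _ (fun a => Lam (rho a))).
Qed.

(** What remains of a relabelling once p has acted: p's new system is independent of the old labels,
    hence the identity at p. *)
Definition upd_relabel L L' p (T : finType) (f : forall i, L' i -> L i) i :
  upd L' p T i -> upd L p T i :=
  match i == p as b return
    Finite.sort (if b then T else L' i) -> Finite.sort (if b then T else L i) with
  | true => id | false => f i end.

(** A relabelling in front is pushed down the tree: at a node, p's Kraus operators absorb the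
    inverse of [f p] and the other components move to the continuations, until a leaf composes with
    them. *)
Lemma LOCC_prerelabel L1 L L' (f : forall i, L i -> L1 i)
    (Lam : op R (Joint L) -> op R (Joint L')) :
  (forall i, bijective (f i)) -> LOCC Lam ->
  LOCC (fun rho => Lam (fun y y' => rho (relabel f y) (relabel f y'))).
Proof.
move=> fb lo; elim: lo L1 f fb => {L L' Lam} [L L' g gb|L L' p T X K Lam cK _ IH] L1 f fb.
  have -> : (fun rho : op R (Joint L1) => fun y y' : Joint L' =>
     rho (relabel f (relabel g y)) (relabel f (relabel g y'))) =
    fun rho y y' => rho (relabel (fun i => f i \o g i) y) (relabel (fun i => f i \o g i) y').
    apply/funext => rho; apply/funext => y; apply/funext => y'.
    by congr (rho _ _); apply/ffunP => i; rewrite !ffunE.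
  by apply: LOCC_relabel => i; apply: bij_comp.
have [g fK gK] := fb p.
have fb' i : bijective (@upd_relabel L1 L p T f i).
  rewrite /upd_relabel /upd; case: (i == p) => //; by exists id.
have eqK x (y : Joint (upd L p T)) z :
  Defs.liftK (fun t a => K x t (g a)) (relabel (@upd_relabel L1 L p T f) y) (relabel f z) =
  Defs.liftK (K x) y z.
  rewrite /Defs.liftK; congr (_ * (nat_of_bool _)%:R).
    have -> : get_new (relabel (@upd_relabel L1 L p T f) y) = get_new y.
      rewrite /get_new ffunE /upd_relabel; move: (y p); rewrite /upd.
      by case: (p == p).
    by rewrite ffunE fK.
  apply: eq_forallb => i; congr (_ ==> _).
  rewrite !ffunE /cmp_old /upd_relabel; move: (y i); rewrite /upd.
  by case: (i == p) => // a; rewrite (inj_eq (bij_inj (fb i))).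
have := @LOCC_step R m L1 L' p T X (fun x t a => K x t (g a))
  (fun x rho => Lam x (fun y y' => rho (relabel (@upd_relabel L1 L p T f) y)
                          (relabel (@upd_relabel L1 L p T f) y'))).
move=> /(_ _ (fun x => IH x _ _ fb')).
have -> : (fun rho y y' => \sum_x Lam x (fun y0 y'0 =>
    conj_by (Defs.liftK (fun t a => K x t (g a))) rho (relabel (@upd_relabel L1 L p T f) y0)
      (relabel (@upd_relabel L1 L p T f) y'0)) y y') =
  (fun rho y y' => \sum_x Lam x (conj_by (Defs.liftK (K x))
      (fun y0 y'0 => rho (relabel f y0) (relabel f y'0))) y y').
  apply/funext => rho; apply/funext => y; apply/funext => y'.
  apply: eq_bigr => x _; congr (Lam x _ y y').
  apply/funext => z; apply/funext => z'; rewrite /conj_by.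
  have bF := onW_bij xpredT (relabel_bij fb).
  rewrite (reindex (relabel f)) //=; apply: eq_bigr => a _.
  rewrite (reindex (relabel f)) //=; apply: eq_bigr => b _.
  by rewrite !eqK.
apply => a b; rewrite cK; congr (nat_of_bool _)%:R.
by rewrite (inj_eq (can_inj gK)).
Qed.

(** The second protocol is grafted onto every leaf of the first; at a node, additivity moves it
    under the sum over outcomes. *)
Lemma LOCC_comp L L1 L' (Lam1 : op R (Joint L) -> op R (Joint L1))
    (Lam2 : op R (Joint L1) -> op R (Joint L')) :
  LOCC Lam1 -> LOCC Lam2 -> LOCC (fun rho => Lam2 (Lam1 rho)).
Proof.
move=> lo lo2; elim: lo Lam2 lo2 => {L L1 Lam1} [L L1 f fb|L L1 p T X K Lam cK _ IH] Lam2 lo2.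
  exact: (LOCC_prerelabel fb lo2).
have -> : (fun rho => Lam2 (fun y y' => \sum_x Lam x (conj_by (Defs.liftK (K x)) rho) y y')) =
  fun rho y y' => \sum_x Lam2 (Lam x (conj_by (Defs.liftK (K x)) rho)) y y'.
  by apply/funext => rho; rewrite LOCC_add.
exact: (LOCC_step cK (fun x => IH x _ lo2)).
Qed.

(* [LOCC_step] for a family of output systems that agrees with [upd] only up to
   bijections; r identifies the basis states of the parties other than p. *)
Lemma LOCC_local L L1 L' p (X : finType) (K : X -> L1 p -> L p -> C)
    (r : forall i, L1 i -> L i -> bool)
    (Lam : X -> op R (Joint L1) -> op R (Joint L')) :
  (forall a b, \sum_x \sum_t Num.conj (K x t a) * K x t b = (a == b)%:R) ->
  (forall i, i != p -> exists2 f : L1 i -> L i, bijective f & forall a b, r i a b = (f a == b)) ->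
  (forall x, LOCC (Lam x)) ->
  LOCC (fun rho y y' => \sum_x Lam x (conj_by (fun (y : Joint L1) (z : Joint L) =>
    K x (y p) (z p) * [forall i, (i != p) ==> r i (y i) (z i)]%:R) rho) y y').
Proof.
move=> cK fr lo.
have {fr} [f fP] : exists f : forall i, i != p -> L1 i -> L i, forall i (h : i != p),
    bijective (f i h) /\ forall a b, r i a b = (f i h a == b).
  have h i : exists g : i != p -> L1 i -> L i, forall h : i != p,
      bijective (g h) /\ forall a b, r i a b = (g h a == b).
    case: (boolP (i == p)) => [_|ip]; first by exists (fun h => False_rect _ (notF h)).
    have [g gb gr] := fr i ip; exists (fun=> g) => _; by split.
  by exists (fun i => projT1 (cid (h i))) => i; exact: (projT2 (cid (h i))).
(* Abstracting the boolean together with its equation allows case analysis on [i == p] although the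
   type of the result depends on it. *)
pose F' i b : (i == p) = b -> L1 i -> Finite.sort (if b then L1 p else L i) :=
  match b with
  | true => fun e => ecast j (L1 i -> L1 j) (eqP e) id
  | false => fun e => f i (negbT e) end.
pose F i : L1 i -> upd L p (L1 p) i := F' i (i == p) erefl.
have Fp (a : L1 p) : (match p == p as b return
     Finite.sort (if b then L1 p else L p) -> option (L1 p) with
   | true => fun z => Some z | false => fun _ => None end) (F p a) = Some a.
  have gen b (e : (p == p) = b) : (match b as b return
      Finite.sort (if b then L1 p else L p) -> option (L1 p) with
    | true => fun z => Some z | false => fun _ => None end) (F' p b e a) = Some a.
    case: b e => [e|]; last by rewrite eqxx.
    by rewrite /F' (eq_axiomK (eqP e)).
  exact: gen.
have Fi i (h : i != p) a b : cmp_old (F i a) b = r i a b.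
  have gen c (e : (i == p) = c) : (match c as b return
      Finite.sort (if b then L1 p else L i) -> Finite.sort (L i) -> bool with
    | true => fun _ _ => true | false => fun a c => a == c end) (F' i c e a) b = r i a b.
    case: c e => [e|e]; first by rewrite e in h.
    by rewrite /F'; have [_ ->] := fP i (negbT e).
  exact: gen.
have Fb i : bijective (F i).
  have gen c (e : (i == p) = c) : bijective (F' i c e).
    case: c e => [e|e]; last by rewrite /F'; have [] := fP i (negbT e).
    by rewrite /F'; case: _ / (eqP e); exists id.
  exact: gen.
have := LOCC_step cK (fun x => LOCC_prerelabel Fb (lo x)).
congr LOCC; apply/funext => rho; apply/funext => y; apply/funext => y'.
apply: eq_bigr => x _; congr (Lam x _ y y'); apply/funext => z; apply/funext => z'.
have eK (a : Joint L1) (b : Joint L) : Defs.liftK (K x) (relabel F a) b =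
  K x (a p) (b p) * [forall i, (i != p) ==> r i (a i) (b i)]%:R.
  rewrite /Defs.liftK /get_new ffunE Fp; congr (_ * (nat_of_bool _)%:R).
  apply: eq_forallb => i; rewrite ffunE.
  by case: (boolP (i == p)) => //= h; rewrite Fi.
by apply: eq_bigr => a _; apply: eq_bigr => b _; rewrite !eK.
Qed.

Definition pairL L M i : finType := (L i * M i)%type.
Definition pairJ L M (x : Joint L) (a : Joint M) : Joint (pairL L M) :=
  [ffun i => (x i, a i)].
Definition fstJ L M (y : Joint (pairL L M)) : Joint L := [ffun i => (y i).1].
Definition sndJ L M (y : Joint (pairL L M)) : Joint M := [ffun i => (y i).2].

Lemma fst_pairJ L M (x : Joint L) (a : Joint M) : fstJ (pairJ x a) = x.
Proof. by apply/ffunP => i; rewrite !ffunE. Qed.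
Lemma snd_pairJ L M (x : Joint L) (a : Joint M) : sndJ (pairJ x a) = a.
Proof. by apply/ffunP => i; rewrite !ffunE. Qed.
Lemma pairJ_eta L M (y : Joint (pairL L M)) : pairJ (fstJ y) (sndJ y) = y.
Proof. by apply/ffunP => i; rewrite !ffunE -surjective_pairing. Qed.

Lemma sum_pairJ L M (F : Joint (pairL L M) -> C) :
  \sum_z F z = \sum_x \sum_a F (pairJ x a).
Proof.
rewrite pair_big /= (reindex (fun xa => pairJ xa.1 xa.2)) //=.
exists (fun y => (fstJ y, sndJ y)) => [[x a] _|y _] /=.
  by rewrite fst_pairJ snd_pairJ.
exact: pairJ_eta.
Qed.

Definition upd_get L p (T : finType) (u : upd L p T p) : option T :=
  (match p == p as b return Finite.sort (if b then T else L p) -> option T with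
   | true => fun z => Some z
   | false => fun _ => None
   end) u.

Lemma sum_upd_get L p (T : finType) (F : option T -> C) :
  \sum_(u : upd L p T p) F (upd_get u) = \sum_t F (Some t).
Proof.
have gen b (e : (p == p) = b) : \sum_(u : (if b then T else L p)) F
  ((match b as b return Finite.sort (if b then T else L p) -> option T with
   | true => fun z => Some z
   | false => fun _ => None
   end) u) = \sum_t F (Some t) by case: b e => //; rewrite eqxx.
exact: gen.
Qed.

(** This is [Lam] tensored with the identity on M: it acts separately on each block given by a row
    index and a column index of M. *)
Definition extL L L' M (Lam : op R (Joint L) -> op R (Joint L'))
    (s : op R (Joint (pairL L M))) : op R (Joint (pairL L' M)) :=
  fun y y' => Lam (fun x x' => s (pairJ x (sndJ y)) (pairJ x' (sndJ y')))
                  (fstJ y) (fstJ y').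

Lemma LOCC_ext L L' M (Lam : op R (Joint L) -> op R (Joint L')) :
  LOCC Lam -> LOCC (@extL L L' M Lam).
Proof.
move=> lo; elim: lo => {L L' Lam} [L L' f fb|L L' p T X K Lam cK _ IH].
  pose f' i : pairL L' M i -> pairL L M i := fun u => (f i u.1, u.2).
  have := @LOCC_relabel R m _ _ f'.
  have e (y : Joint (pairL L' M)) : relabel f' y = pairJ (relabel f (fstJ y)) (sndJ y).
    by apply/ffunP => i; rewrite !ffunE.
  have -> : (fun rho y y' => rho (relabel f' y) (relabel f' y')) =
     @extL L L' M (fun (rho : op R (Joint L)) (y y' : Joint L') => rho (relabel f y) (relabel f y')).
    by apply/funext => rho; apply/funext => y; apply/funext => y'; rewrite !e.
  apply=> i; have [g fK gK] := fb i.
  by exists (fun u => (g u.1, u.2)) => -[u v]; rewrite /f' /= ?fK ?gK.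
(* The Kraus operator tensored with the identity on p's own part of M; the other parts of M are
   preserved by the relation [r]. *)
pose K1 x (u : pairL (upd L p T) M p) (z : pairL L M p) : C :=
  (if upd_get u.1 is Some t then K x t z.1 else 0) * (u.2 == z.2)%:R.
pose r i (u : pairL (upd L p T) M i) (z : pairL L M i) := cmp_old u.1 z.1 && (u.2 == z.2).
have := @LOCC_local (pairL L M) (pairL (upd L p T) M) (pairL L' M) p X K1 r
   (fun x => extL (Lam x)).
have cK1 (a b : pairL L M p) :
    \sum_x \sum_t Num.conj (K1 x t a) * K1 x t b = (a == b)%:R.
  transitivity (\sum_x \sum_t (a.2 == b.2)%:R * (Num.conj (K x t a.1) * K x t b.1)).
    apply: eq_bigr => x _; rewrite -(pair_bigA _ (fun u c => Num.conj (K1 x (u, c) a) * K1 x (u, c) b)) /=.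
    transitivity (\sum_(u : upd L p T p) (a.2 == b.2)%:R *
      (if upd_get u is Some t then Num.conj (K x t a.1) * K x t b.1 else 0)).
      apply: eq_bigr => u _; rewrite /K1 /=; case: (upd_get u) => [t|].
        transitivity (\sum_c (c == a.2)%:R * ((c == b.2)%:R * (Num.conj (K x t a.1) * K x t b.1))).
          by apply: eq_bigr => c _; rewrite rmorphM /= conjC_nat; ring.
        by rewrite sum_pick.
      by rewrite mulr0 big1 // => c _; rewrite !mul0r mulr0.
    rewrite -!mulr_sumr; congr (_ * _).
    exact: (@sum_upd_get L p T (fun o => if o is Some t then Num.conj (K x t a.1) * K x t b.1 else 0)).
  under eq_bigr => x _ do rewrite -mulr_sumr.
  by rewrite -mulr_sumr cK -natrM mulnb andbC; case: a b => [a1 a2] [b1 b2].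
have hr i : i != p -> exists2 f : pairL (upd L p T) M i -> pairL L M i,
    bijective f & forall a b, r i a b = (f a == b).
  rewrite /r /pairL /cmp_old /upd => /negPf ip; rewrite ip.
  by exists id => //; exists id.
move=> /(_ cK1 hr IH); congr LOCC.
apply/funext => s; apply/funext => y; apply/funext => y'; rewrite /extL.
apply: eq_bigr => x _; congr (Lam x _ _ _); apply/funext => u; apply/funext => u'.
have eK (v : Joint (upd L p T)) (a b : Joint M) (z : Joint L) :
  K1 x (pairJ v a p) (pairJ z b p) *
   [forall i, (i != p) ==> r i (pairJ v a i) (pairJ z b i)]%:R =
  (b == a)%:R * Defs.liftK (K x) v z.
  rewrite /K1 /Defs.liftK /get_new !ffunE /= -/(upd_get (v p)).
  rewrite -mulrA mulrCA mulrC -mulrA; rewrite [in RHS]mulrCA; congr (_ * _).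
  rewrite -!natrM !mulnb; congr (nat_of_bool _)%:R.
  apply/andP/andP => [[/forallP h /eqP e]|[/eqP -> /forallP h]].
    split; last by apply/forallP => i; have := h i; rewrite /r !ffunE /=; case: (i != p) => //= /andP[].
    apply/eqP/ffunP => i; have [->//|ip] := eqVneq i p.
    by have := h i; rewrite ip /r !ffunE /= => /andP[_ /eqP ->].
  split=> //; apply/forallP => i; have := h i; rewrite /r !ffunE /=.
  by case: (i != p) => //= ->; rewrite eqxx.
rewrite /conj_by sum_pairJ; apply: eq_bigr => z _.
under eq_bigr => a _ do rewrite sum_pairJ.
under eq_bigr => a _ do under eq_bigr => z' _ do under eq_bigr => a' _ do
   rewrite !eK rmorphM /= conjC_nat.
transitivity (\sum_a (a == sndJ y)%:R * (\sum_z' \sum_a' (a' == sndJ y')%:R *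
   (Defs.liftK (K x) u z * s (pairJ z a) (pairJ z' a') * Num.conj (Defs.liftK (K x) u' z')))).
  apply: eq_bigr => a _; rewrite !mulr_sumr; apply: eq_bigr => z' _.
  rewrite mulr_sumr; apply: eq_bigr => a' _; ring.
by rewrite sum_pick; apply: eq_bigr => z' _; rewrite sum_pick.
Qed.

Definition tens L M (t1 : op R (Joint L)) (t2 : op R (Joint M)) : op R (Joint (pairL L M)) :=
  fun y y' => t1 (fstJ y) (fstJ y') * t2 (sndJ y) (sndJ y').

Definition swapL L M i (u : pairL M L i) : pairL L M i := (u.2, u.1).

Lemma swapL_bij L M i : bijective (@swapL L M i).
Proof. by exists (@swapL M L i) => -[]. Qed.

(** The two protocols run one after the other, each extended by an idle system, with swaps in
    between. On a product operator the idle factor is a scalar for each block and comes out by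
    [LOCC_scale]. *)
Lemma LOCC_tensor L L' M M' (Lam1 : op R (Joint L) -> op R (Joint L'))
    (Lam2 : op R (Joint M) -> op R (Joint M')) : LOCC Lam1 -> LOCC Lam2 ->
  exists2 Lam : op R (Joint (pairL L M)) -> op R (Joint (pairL L' M')),
    LOCC Lam & forall t1 t2, Lam (tens t1 t2) = tens (Lam1 t1) (Lam2 t2).
Proof.
move=> lo1 lo2.
have h1 := LOCC_ext M lo1; have h2 := LOCC_ext L' lo2.
have := LOCC_prerelabel (@swapL_bij L' M) h2.
have := LOCC_relabel R (@swapL_bij M' L').
move=> h4 h3; have := LOCC_comp h1 (LOCC_comp h3 h4) => lo.
exists (fun s y y' => extL Lam2 (fun z z' => extL Lam1 s (relabel (@swapL L' M) z) (relabel (@swapL L' M) z'))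
   (relabel (@swapL M' L') y) (relabel (@swapL M' L') y')) => // t1 t2.
apply/funext => y; apply/funext => y'; rewrite /extL.
have sw A B (x : Joint A) (b : Joint B) : relabel (@swapL B A) (pairJ x b) = pairJ b x.
  by apply/ffunP => i; rewrite !ffunE.
have -> : (fun x x' => Lam1 (fun z z' => tens t1 t2
    (pairJ z (sndJ (relabel (@swapL L' M) (pairJ x (sndJ (relabel (@swapL M' L') y))))))
    (pairJ z' (sndJ (relabel (@swapL L' M) (pairJ x' (sndJ (relabel (@swapL M' L') y')))))))
    (fstJ (relabel (@swapL L' M) (pairJ x (sndJ (relabel (@swapL M' L') y)))))
    (fstJ (relabel (@swapL L' M) (pairJ x' (sndJ (relabel (@swapL M' L') y')))))) =
  fun x x' => Lam1 t1 (fstJ y) (fstJ y') * t2 x x'.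
  apply/funext => x; apply/funext => x'; rewrite !sw !fst_pairJ !snd_pairJ.
  have fs (z : Joint (pairL L' M')) : sndJ (relabel (@swapL M' L') z) = fstJ z.
    by apply/ffunP => i; rewrite !ffunE.
  rewrite !fs /tens.
  have -> : (fun z z' => t1 (fstJ (pairJ z x)) (fstJ (pairJ z' x')) *
     t2 (sndJ (pairJ z x)) (sndJ (pairJ z' x'))) = fun z z' => t2 x x' * t1 z z'.
    apply/funext => z; apply/funext => z'.
    by rewrite !fst_pairJ !snd_pairJ mulrC.
  by rewrite (LOCC_scale _ _ lo1) mulrC.
rewrite (LOCC_scale _ _ lo2) /tens; congr (_ * Lam2 _ _ _);
  by apply/ffunP => i; rewrite !ffunE.
Qed.

(** Distributing the product over the spectral sums of the n factors gives a Gram form indexed by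
    n-tuples of eigenvectors. *)
Lemma tensor_pow_psd L (rho : op R (Joint L)) n : psd rho -> psd (tensor_pow (n := n) rho).
Proof.
move=> /psd_spectral [s [M [s0 _ ->]]].
have s0' (k : {ffun 'I_n -> Joint L}) : 0 <= \prod_t s (k t) by apply: prodr_ge0.
have := @psd_gram R (Joint (Lcopies L n)) {ffun 'I_n -> Joint L}
  (fun k => \prod_t s (k t)) (fun k x => \prod_t M (k t) (slice x t))
  (fun k => s0' k).
congr psd; apply/funext => x; apply/funext => y; rewrite /tensor_pow.
rewrite (bigA_distr_bigA (fun t k => s k * Num.conj (M k (slice x t)) * M k (slice y t))) /=.
by apply: eq_bigr => k _; rewrite rmorph_prod -!big_split.
Qed.

Lemma tensor_pow_trace L (rho : op R (Joint L)) n :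
  trace rho = 1 -> trace (tensor_pow (n := n) rho) = 1.
Proof.
move=> tr; rewrite /trace /tensor_pow.
pose F (k : {ffun 'I_n -> Joint L}) : Joint (Lcopies L n) :=
  [ffun i => [ffun t => k t i]].
rewrite (reindex F) /=; last first.
  exists (fun x => [ffun t => slice x t]) => x _.
    by apply/ffunP => t; apply/ffunP => i; rewrite !ffunE.
  by apply/ffunP => i; apply/ffunP => t; rewrite !ffunE.
have e k t : slice (F k) t = k t by apply/ffunP => i; rewrite !ffunE.
under eq_bigr => k _ do under eq_bigr => t _ do rewrite e.
rewrite -(bigA_distr_bigA (fun t (k : Joint L) => rho k k)) /=.
by rewrite big1 // => t _; exact: tr.
Qed.

Definition join_copies L n1 n2 i (u : pairL (Lcopies L n1) (Lcopies L n2) i) : Lcopies L (n1 + n2) i :=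
  [ffun t => match fintype.split t with inl s => u.1 s | inr s => u.2 s end].

Lemma join_copies_bij L n1 n2 i : bijective (@join_copies L n1 n2 i).
Proof.
exists (fun w : Lcopies L (n1 + n2) i => ([ffun t => w (lshift n2 t)], [ffun t => w (rshift n1 t)])
  : pairL (Lcopies L n1) (Lcopies L n2) i).
  move=> [u v]; rewrite /join_copies; congr (_, _); apply/ffunP => t; rewrite !ffunE.
    by case: (splitP (lshift n2 t)) => [j|k] /= e; [congr (u _); apply: val_inj|
      have := ltn_ord t; rewrite e ltnNge leq_addr].
  case: (splitP (rshift n1 t)) => [j|k] /= e; last by congr (v _); apply: val_inj; apply: (@addnI n1).
  by have := ltn_ord j; rewrite -e ltnNge leq_addr.
move=> w; apply/ffunP => t; rewrite !ffunE /=.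
by case: (splitP t) => j e; rewrite ffunE; congr (w _); apply: val_inj.
Qed.

Lemma tensor_pow_join L (rho : op R (Joint L)) n1 n2 :
  (fun y y' => tensor_pow rho (relabel (@join_copies L n1 n2) y) (relabel (@join_copies L n1 n2) y')) =
  tens (tensor_pow (n := n1) rho) (tensor_pow (n := n2) rho).
Proof.
apply/funext => y; apply/funext => y'; rewrite /tensor_pow big_split_ord /=.
have el (z : Joint (pairL (Lcopies L n1) (Lcopies L n2))) t :
    slice (relabel (@join_copies L n1 n2) z) (lshift n2 t) = slice (fstJ z) t.
  apply/ffunP => i; rewrite !ffunE.
  by case: (splitP (lshift n2 t)) => [j|k] /= e; [congr ((z i).1 _); apply: val_inj|
      have := ltn_ord t; rewrite e ltnNge leq_addr].
have er (z : Joint (pairL (Lcopies L n1) (Lcopies L n2))) t :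
    slice (relabel (@join_copies L n1 n2) z) (rshift n1 t) = slice (sndJ z) t.
  apply/ffunP => i; rewrite !ffunE.
  case: (splitP (rshift n1 t)) => [j|k] /= e; last by congr ((z i).2 _); apply: val_inj; apply: (@addnI n1).
  by have := ltn_ord j; rewrite -e ltnNge leq_addr.
by congr (_ * _); apply: eq_bigr => t _; rewrite ?el ?er.
Qed.
End LOCCTheory.

(** * Overlaps as class sums *)

Section ClassSum.
Variables (R : realType).
Local Notation C := (R[i]).

(* Sum, over the classes of [key] restricted to [A], of <c|s|c> with |c> the
   sum of the basis vectors of the class.  All the overlaps below have this form. *)
Definition class_sum (T K : finType) (A : pred T) (key : T -> K) (s : op R T) : C :=
  \sum_z \sum_z' [&& A z, A z' & key z == key z']%:R * s z z'.

Lemma eq_class_sum (T K K' : finType) (A A' : pred T) (key : T -> K) (key' : T -> K') (s : op R T) :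
  (forall z z', [&& A z, A z' & key z == key z'] = [&& A' z, A' z' & key' z == key' z']) ->
  class_sum A key s = class_sum A' key' s.
Proof. by move=> e; apply: eq_bigr => z _; apply: eq_bigr => z' _; rewrite e. Qed.

Lemma class_sum_form (T K : finType) (A : pred T) (key : T -> K) (s : op R T) :
  class_sum A key s =
  \sum_k sform s (fun z => (A z && (key z == k))%:R) (fun z => (A z && (key z == k))%:R).
Proof.
rewrite /class_sum /sform [RHS]exchange_big /=; apply: eq_bigr => z _.
rewrite [RHS]exchange_big /=; apply: eq_bigr => z' _.
under eq_bigr => k _ do rewrite conjC_nat.
transitivity (\sum_k (k == key z)%:R * ((A z)%:R * s z z' * (A z' && (key z' == k))%:R)).
  rewrite sum_pick mulrAC -natrM mulnb; congr ((nat_of_bool _)%:R * _).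
  by rewrite eq_sym.
apply: eq_bigr => k _; rewrite -!mulnb !natrM eq_sym; ring.
Qed.

Lemma sform_sum (T X : finType) (s : op R T) (v w : X -> T -> C) :
  sform s (fun z => \sum_c v c z) (fun z => \sum_c w c z) =
  \sum_c \sum_d sform s (v c) (w d).
Proof.
transitivity (\sum_x \sum_y \sum_c \sum_d Num.conj (v c x) * s x y * w d y).
  apply: eq_bigr => x _; apply: eq_bigr => y _.
  rewrite rmorph_sum mulr_suml mulr_suml; apply: eq_bigr => c _.
  by rewrite mulr_sumr.
under eq_bigr => x _ do rewrite exchange_big /=.
rewrite exchange_big /=; apply: eq_bigr => c _.
under eq_bigr => x _ do rewrite exchange_big /=.
by rewrite exchange_big.
Qed.

(** The nonnegative forms at [v c - v d], summed over all pairs (c, d), equal twice the difference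
    of the two sides. *)
Lemma sform_cauchy (T X : finType) (s : op R T) (v : X -> T -> C) : psd s ->
  sform s (fun z => \sum_c v c z) (fun z => \sum_c v c z) <=
  #|X|%:R * \sum_c sform s (v c) (v c).
Proof.
move=> ps; rewrite sform_sum.
have h : 0 <= \sum_c \sum_d sform s (fun z => v c z + (-1) * v d z) (fun z => v c z + (-1) * v d z).
  by apply: sumr_ge0 => c _; apply: sumr_ge0 => d _; apply: psd_sform.
have e : \sum_c \sum_d sform s (fun z => v c z + (-1) * v d z) (fun z => v c z + (-1) * v d z) =
   (#|X|%:R * \sum_c sform s (v c) (v c) - \sum_c \sum_d sform s (v c) (v d)) *+ 2.
  transitivity (\sum_c \sum_d (sform s (v c) (v c) - sform s (v c) (v d) - sform s (v d) (v c) + sform s (v d) (v d))).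
    apply: eq_bigr => c _; apply: eq_bigr => d _.
    by rewrite sform_comb rmorphN rmorph1; ring.
  under eq_bigr => c _ do rewrite !big_split /= !sumrN sumr_const.
  rewrite !big_split /= !sumrN [X in _ - X]exchange_big /= sumr_const.
  have e2 (a b : C) : a - b - b + a = (a - b) *+ 2 by ring.
  by rewrite sumrMnl mulr_natl; exact: e2.
by move: h; rewrite e pmulrn_lge0 // subr_ge0.
Qed.

(** The price of losing the coherence between different values of [chi]: each class splits into at
    most #|X| pieces. *)
Lemma class_sum_split (T K X : finType) (A : pred T) (key : T -> K) (chi : T -> X) (s : op R T) :
  psd s -> class_sum A key s <= #|X|%:R * class_sum A (fun z => (key z, chi z)) s.
Proof.
move=> ps; rewrite !class_sum_form -(pair_bigA _ (fun k x => sform s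
  (fun z => (A z && ((key z, chi z) == (k, x)))%:R) (fun z => (A z && ((key z, chi z) == (k, x)))%:R))) /=.
rewrite mulr_sumr; apply: ler_sum => k _.
have := @sform_cauchy T X s (fun x z => (A z && ((key z, chi z) == (k, x)))%:R) ps.
congr (sform _ _ _ <= _); apply/funext => z;
  rewrite -[RHS](sum_pick (chi z) (fun=> (A z && (key z == k))%:R)); apply: eq_bigr => x _;
  rewrite -natrM mulnb xpair_eqE [x == _]eq_sym; congr (nat_of_bool _)%:R;
  by case: (A z); case: (key z == k); case: (_ == x).
Qed.

(** Since B looks only at the key, it removes whole classes, and each class contributes a
    nonnegative term. *)
Lemma class_sum_sub (T K : finType) (A : pred T) (B : pred K) (key : T -> K) (s : op R T) :
  psd s -> class_sum (fun z => A z && B (key z)) key s <= class_sum A key s.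
Proof.
move=> ps; rewrite !class_sum_form; apply: ler_sum => k _.
case Bk: (B k).
  have -> : (fun z => ((A z && B (key z)) && (key z == k))%:R : C) = (fun z => (A z && (key z == k))%:R).
    apply/funext => z; congr (nat_of_bool _)%:R.
    by case: eqP => [->|]; rewrite ?Bk ?andbT ?andbF.
  exact: lexx.
rewrite [X in X <= _](_ : _ = 0) ?psd_sform // /sform big1 // => z _; rewrite big1 // => z' _.
have -> : ((A z' && B (key z')) && (key z' == k)) = false.
  by case: eqP => [->|]; rewrite ?Bk ?andbF.
by rewrite mulr0.
Qed.

(** The operators send the basis state z to [phi z] while announcing [chi z]. Entries between states
    with different announcements are lost, so the announcement joins the key. *)
Lemma class_sum_push (T U X K : finType) (A : pred U) (key : U -> K) (phi : T -> U) (chi : T -> X) (s : op R T) :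
  class_sum A key (fun y y' => \sum_x conj_by (fun y z => ((phi z == y) && (chi z == x))%:R) s y y') =
  class_sum (fun z => A (phi z)) (fun z => (key (phi z), chi z)) s.
Proof.
rewrite /class_sum /conj_by.
transitivity (\sum_y \sum_y' \sum_x \sum_z \sum_z' (y' == phi z')%:R * ((y == phi z)%:R *
   ((x == chi z)%:R * ((x == chi z')%:R * [&& A y, A y' & key y == key y']%:R * s z z')))).
  apply: eq_bigr => y _; apply: eq_bigr => y' _.
  rewrite mulr_sumr; apply: eq_bigr => x _; rewrite mulr_sumr; apply: eq_bigr => z _.
  rewrite mulr_sumr; apply: eq_bigr => z' _; rewrite conjC_nat -(mulnb (phi z == y)) -(mulnb (phi z' == y')) !natrM.
  by rewrite ![phi _ == _]eq_sym ![chi _ == _]eq_sym; ring.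
under eq_bigr => y _ do under eq_bigr => y' _ do rewrite exchange_big /=.
under eq_bigr => y _ do rewrite exchange_big /=.
rewrite exchange_big /=; apply: eq_bigr => z _.
under eq_bigr => y _ do under eq_bigr => y' _ do rewrite exchange_big /=.
under eq_bigr => y _ do rewrite exchange_big /=.
rewrite exchange_big /=; apply: eq_bigr => z' _.
under eq_bigr => y _ do under eq_bigr => y' _ do rewrite -mulr_sumr.
under eq_bigr => y _ do rewrite sum_pick.
under eq_bigr => y _ do rewrite -mulr_sumr.
rewrite sum_pick sum_pick -natrM mulnb; congr ((nat_of_bool _)%:R * _).
by rewrite xpair_eqE; case: (A _); case: (A _); case: (key _ == _); rewrite ?andbF ?andbT.
Qed.

Lemma class_sum_tens (m : nat) (L M : 'I_m -> finType) (K K' : finType) (A : pred (Joint L)) (B : pred (Joint M))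
   (key : Joint L -> K) (key' : Joint M -> K') (t1 : op R (Joint L)) (t2 : op R (Joint M)) :
  class_sum A key t1 * class_sum B key' t2 =
  class_sum (fun z => A (fstJ z) && B (sndJ z)) (fun z => (key (fstJ z), key' (sndJ z))) (tens t1 t2).
Proof.
rewrite /class_sum sum_pairJ mulr_suml; apply: eq_bigr => z _.
rewrite mulr_sumr; apply: eq_bigr => w _.
rewrite sum_pairJ mulr_suml; apply: eq_bigr => z' _.
rewrite mulr_sumr; apply: eq_bigr => w' _.
rewrite /tens !fst_pairJ !snd_pairJ xpair_eqE mulrACA -natrM mulnb; congr ((nat_of_bool _)%:R * _).
by case: (A z); case: (A z'); case: (key z == _); case: (B w); case: (B w').
Qed.

Lemma class_sum_reindex (T U K : finType) (F : U -> T) (A : pred T) (key : T -> K) (s : op R T) :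
  bijective F ->
  class_sum (fun y => A (F y)) (fun y => key (F y)) (fun y y' => s (F y) (F y')) =
  class_sum A key s.
Proof.
move=> bF; have bF' := onW_bij xpredT bF.
rewrite /class_sum [RHS](reindex F) //=; apply: eq_bigr => y _.
by rewrite [RHS](reindex F).
Qed.

(** A computation in the basis is a valid instrument as soon as the new state and the outcome
    together determine the old state. *)
Lemma classical_complete (T U X : finType) (phi : T -> U) (chi : T -> X) :
  injective (fun a => (phi a, chi a)) -> forall a b,
  \sum_x \sum_t Num.conj ((phi a == t) && (chi a == x))%:R * ((phi b == t) && (chi b == x))%:R
  = (a == b)%:R :> C.
Proof.
move=> inj a b.
transitivity (\sum_x (x == chi a)%:R * (\sum_t (t == phi a)%:R * ((phi b == t) && (chi b == x))%:R) : C).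
  apply: eq_bigr => x _; rewrite mulr_sumr; apply: eq_bigr => t _.
  by rewrite conjC_nat -mulnb natrM [phi a == t]eq_sym [chi a == x]eq_sym; ring.
by rewrite !sum_pick -xpair_eqE (inj_eq inj) eq_sym.
Qed.

End ClassSum.

(** * Bit strings: padding, truncation and addition modulo 2 *)

Section Bits.

Definition pad (k k' : nat) (q : Qk k) : Qk k' :=
  [ffun t : 'I_k' => if insub (val t) is Some s then q s else false].

Definition xorq (k : nat) (a b : Qk k) : Qk k := [ffun t => a t (+) b t].

Definition zeroq (k : nat) : Qk k := [ffun=> false].

Lemma padK k k' (q : Qk k) : (k <= k')%N -> pad k (pad k' q) = q.
Proof.
move=> le; apply/ffunP => t; rewrite !ffunE.
have tk : (val t < k')%N by exact: leq_trans (ltn_ord t) le.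
by rewrite insubT ffunE /= valK.
Qed.

Lemma xorqK k (a b : Qk k) : xorq (xorq a b) b = a.
Proof. by apply/ffunP => t; rewrite !ffunE addbK. Qed.

Lemma xorqC k (a b : Qk k) : xorq a b = xorq b a.
Proof. by apply/ffunP => t; rewrite !ffunE addbC. Qed.

Lemma xorq_eq0 k (a b : Qk k) : (xorq a b == zeroq k) = (a == b).
Proof.
apply/eqP/eqP => [/ffunP e|->]; apply/ffunP => t; last by rewrite !ffunE addbb.
by have := e t; rewrite !ffunE; case: (a t); case: (b t).
Qed.

(* [pad k u] truncates u when k <= k2; [rest] keeps the other bits. *)
Definition rest (k k2 : nat) (u : Qk k2) : Qk k2 := xorq u (pad k2 (pad k u)).

Lemma pad_rest_inj k k2 (u u' : Qk k2) :
  pad k u = pad k u' -> rest k u = rest k u' -> u = u'.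
Proof.
rewrite /rest => -> /(congr1 (fun x => xorq x (pad k2 (pad k u')))).
by rewrite !xorqK.
Qed.

End Bits.

(** * GHZ states on a growing set of parties *)

Section Shares.
Variables (R : realType) (m : nat).
Local Notation C := (R[i]).
Implicit Types (L M A B J Lf : 'I_m -> finType) (p : 'I_m).

Definition agree Lf k (h : forall i, Lf i -> Qk k) (S : {set 'I_m}) (z : Joint Lf) : bool :=
  [forall i in S, forall j in S, h i (z i) == h j (z j)].

Lemma agreeP Lf k (h : forall i, Lf i -> Qk k) (S : {set 'I_m}) (z : Joint Lf) :
  reflect (forall i j, i \in S -> j \in S -> h i (z i) = h j (z j)) (agree h S z).
Proof.
apply: (iffP forall_inP) => [H i j iS jS|H i iS].
  by have /forall_inP/(_ j jS)/eqP := H i iS.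
by apply/forall_inP => j jS; apply/eqP/H.
Qed.

(* N copies of rho yield k GHZ states among the parties of S with squared
   fidelity at least v.  Party i holds a system Lf i with a k-bit register h
   and an uncontrolled remainder g; outside S everything is remainder.  Only
   classes of equal remainder are summed coherently, i.e. the remainders are
   traced out without being discarded physically. *)
Definition shares L (rho : op R (Joint L)) (S : {set 'I_m}) (k N : nat) (v : C) : Prop :=
  exists Lf J (h : forall i, Lf i -> Qk k) (g : forall i, Lf i -> J i)
    (Lam : op R (Joint (Lcopies L N)) -> op R (Joint Lf)),
  [/\ LOCC Lam, forall i, injective (fun a => (h i a, g i a)),
      forall i, i \notin S -> injective (g i) &
      v <= (2 ^+ k)^-1 * class_sum (agree h S) (relabel g) (Lam (tensor_pow (n := N) rho))].

Lemma card_Qk k : #|{: Qk k}| = (2 ^ k)%N.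
Proof. by rewrite card_ffun card_bool card_ord. Qed.

(* For one party the k GHZ states are the local superposition of all k-bit
   strings; the other registers have 0 bits, so that [pad] turns them into 0.
   All N copies go to the remainder, so N is arbitrary. *)
Lemma shares_singleton L (rho : op R (Joint L)) r k N :
  trace rho = 1 -> shares rho [set r] k N 1.
Proof.
move=> /(tensor_pow_trace N) tr.
pose kk i : nat := if i == r then k else 0%N.
pose Q i : finType := Qk (kk i).
have kkr : kk r = k by rewrite /kk eqxx.
have kk_le i : (kk i <= k)%N by rewrite /kk; case: ifP.
have Q0 i (a b : Q i) : i != r -> a = b.
  move=> /negPf ir; have e : kk i = 0%N by rewrite /kk ir.
  by apply/ffunP => t; have := leq_trans (ltn_ord t) (eq_leq e).
pose Lf := pairL Q (Lcopies L N).
pose h i (a : Lf i) : Qk k := pad k a.1.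
pose g i (a : Lf i) : Lcopies L N i := a.2.
have cardQ : #|{: Joint Q}| = (2 ^ k)%N.
  rewrite -card_Qk; apply: (bij_eq_card (f := fun y : Joint Q => pad k (y r))).
  exists (fun q => [ffun i => pad (kk i) q]) => [y|q]; last by rewrite ffunE padK ?kkr.
  apply/ffunP => i; rewrite ffunE; have [->|ir] := eqVneq i r; first by rewrite padK.
  exact: Q0.
pose c : C := (sqrtC (2 ^+ k))^-1.
have cc : Num.conj c * c = (2 ^+ k)^-1.
  have c0 : 0 <= c by rewrite invr_ge0 sqrtC_ge0 exprn_ge0.
  have -> : Num.conj c = c by apply/CrealP/ger0_real.
  by rewrite -expr2 /c exprVn sqrtCK.
have p0 : (2 ^+ k : C) != 0 by rewrite expf_neq0 // pnatr_eq0.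
(* Party r adjoins a uniform superposition of the 2^k strings to its copies. The amplitude [c] =
   2^(-k/2) makes this an isometry, with a single outcome. *)
pose K (x : unit) (u : Lf r) (a : Lcopies L N r) : C := c * (u.2 == a)%:R.
pose rr i (u : Lf i) (a : Lcopies L N i) := u.2 == a.
have cK (a b : Lcopies L N r) : \sum_x \sum_t Num.conj (K x t a) * K x t b = (a == b)%:R.
  rewrite (big_pred1 tt) => [|[]] //.
  rewrite -(pair_bigA _ (fun (q : Q r) e => Num.conj (K tt (q, e) a) * K tt (q, e) b)) /=.
  transitivity (\sum_(q : Q r) (2 ^+ k)^-1 * (a == b)%:R : C).
    apply: eq_bigr => q _; rewrite -(sum_pick a (fun e => (2 ^+ k)^-1 * (e == b)%:R)).
    by apply: eq_bigr => e _; rewrite /K /= rmorphM /= conjC_nat -cc; ring.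
  rewrite sumr_const.
  have -> : #|xpredT : pred (Q r)| = (2 ^ k)%N by rewrite -card_Qk /Q kkr.
  by rewrite -[LHS]mulr_natl natrX mulrA mulfV // mul1r.
have hr i : i != r -> exists2 f : Lf i -> Lcopies L N i, bijective f & forall a b, rr i a b = (f a == b).
  move=> ir; exists snd => //; exists (fun b => (pad (kk i) (zeroq 0), b)) => [[q b]|b] //=.
  by congr (_, _); apply: Q0.
have lid : forall x : unit, LOCC (fun (rho : op R (Joint Lf)) y y' => rho (relabel (fun i => @id (Lf i)) y) (relabel (fun i => @id (Lf i)) y')).
  by move=> _; apply: LOCC_relabel => i; exists id.
have lo := LOCC_local cK hr lid.
exists Lf, (Lcopies L N), h, g; eexists; split; first exact: lo.
- move=> i [a b] [a' b']; rewrite /h /g /= => -[e ->]; congr (_, _).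
  by rewrite -(padK a (kk_le i)) e padK.
- move=> i; rewrite finset.in_set1 => ir [a b] [a' b']; rewrite /g /= => ->; congr (_, _).
  exact: Q0.
cbv beta.
have idJ (y : Joint Lf) : relabel (fun i => @id (Lf i)) y = y by apply/ffunP => i; rewrite ffunE.
set s := (X in class_sum _ _ X).
have -> : s = fun y y' => (2 ^+ k)^-1 * tensor_pow (n := N) rho (sndJ y) (sndJ y').
  apply/funext => y; apply/funext => y'; rewrite /s (big_pred1 tt) => [|[]] //.
  rewrite !idJ /conj_by.
  have eK (u : Joint Lf) (z : Joint (Lcopies L N)) : K tt (u r) (z r) * [forall i, (i != r) ==> rr i (u i) (z i)]%:R =
     c * (z == sndJ u)%:R.
    rewrite /K -mulrA -natrM mulnb; congr (_ * (nat_of_bool _)%:R).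
    apply/andP/eqP => [[/eqP e /forallP H]|->].
      apply/ffunP => i; rewrite ffunE; have [->//|ir] := eqVneq i r.
      by have := H i; rewrite ir => /eqP.
    by rewrite ffunE eqxx; split=> //; apply/forallP => i; rewrite /rr ffunE eqxx implybT.
  transitivity (\sum_z (z == sndJ y)%:R * \sum_z' (z' == sndJ y')%:R * ((2 ^+ k)^-1 * tensor_pow (n := N) rho z z')).
    apply: eq_bigr => z _; rewrite mulr_sumr; apply: eq_bigr => z' _.
    by rewrite !eK rmorphM /= conjC_nat -cc; ring.
  by rewrite !sum_pick.
rewrite /class_sum sum_pairJ.
have tA z : agree h [set r] z.
  by apply/agreeP => i j; rewrite !finset.in_set1 => /eqP -> /eqP ->.
have sg (z : Joint Lf) : relabel g z = sndJ z by apply/ffunP => i; rewrite !ffunE.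
under eq_bigr => q _ do under eq_bigr => a _ do rewrite sum_pairJ.
under eq_bigr => q _ do under eq_bigr => a _ do under eq_bigr => q' _ do under eq_bigr => a' _ do
  rewrite !tA !sg !snd_pairJ /= eq_sym.
under eq_bigr => q _ do under eq_bigr => a _ do under eq_bigr => q' _ do rewrite sum_pick.
(* Agreement within one party is automatic, so both string indices range freely. Their 2^k * 2^k
   terms cancel the two factors 2^-k, and the copies contribute the trace of the state. *)
under eq_bigr => q _ do under eq_bigr => a _ do rewrite sumr_const -[_ *+ #|_|]mulr_natl.
under eq_bigr => q _ do rewrite -!mulr_sumr -/(trace _) tr mulr1.
rewrite sumr_const -[X in _ * X]mulr_natl.
have -> : #|xpredT : pred (Joint Q)| = (2 ^ k)%N by rewrite -cardQ.
by rewrite natrX mulfV // mulr1 mulVf.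
Qed.

(** States with equal keys differ at most at i and j; this is the coherence that survives tracing
    out the other parties. *)
Definition epr_key k (i j : 'I_m) (w : Joint (Lqubits (m := m) k)) : Joint (Lqubits (m := m) k) :=
  [ffun l => if (l == i) || (l == j) then zeroq k else w l].

(* Party i measures the sum of its GHZ register and its EPR half, and j adds
   the outcome c to its own half, which then continues the GHZ register.  The
   measurement decoheres the 2^k2 values of c; the Cauchy-Schwarz step
   [class_sum_split] costs exactly the factor 2^k2 by which the normalisation
   of the EPR pairs exceeds that of the output. *)
Lemma shares_fuse L (rho : op R (Joint L)) (S : {set 'I_m}) (i j : 'I_m) k k2 N n2 (v1 v2 : C)
    (Lam2 : op R (Joint (Lcopies L n2)) -> op R (Joint (Lqubits k2))) :
  psd rho -> i \in S -> j \notin S -> (k <= k2)%N -> 0 <= v1 -> 0 <= v2 ->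
  shares rho S k N v1 -> LOCC Lam2 ->
  v2 <= (2 ^+ k2)^-1 * class_sum (fun w : Joint (Lqubits k2) => w i == w j) (epr_key i j)
     (Lam2 (tensor_pow (n := n2) rho)) ->
  shares rho (j |: S) k (N + n2) (v1 * v2).
Proof.
move=> prho iS jS le_k v1_0 v2_0 [Lf [J [h [g [Lam1 [lo1 hgI gI v1P]]]]]] lo2 v2P.
have ij : i != j by apply: contraNneq jS => <-.
pose QL := Lqubits (m := m) k2.
pose LF := pairL Lf QL.
have [LamT loT LamTE] := LOCC_tensor lo1 lo2.
(* [chi] is the announced outcome and [phi] the basis state after the correction. Party i resets its
   half, which the outcome and its GHZ register determine; if the two halves were equal, j ends up
   with the padded register of i. *)
pose chi (z : Joint LF) : Qk k2 := xorq (z i).2 (pad k2 (h i (z i).1)).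
pose phi (z : Joint LF) : Joint LF := [ffun l =>
  if l == i then ((z l).1, zeroq k2) else
  if l == j then ((z l).1, xorq (z l).2 (chi z)) else z l].
(* The first k bits of j's corrected half become its register. Its other k2 - k bits and its whole
   old system, which lay outside S, are remainder. *)
pose h' l (u : LF l) : Qk k := if l == j then pad k u.2 else h l u.1.
pose g' l (u : LF l) : pairL J QL l := (g l u.1, if l == j then rest k u.2 else u.2).
pose phi0 (a : LF i) : LF i := (a.1, zeroq k2).
pose chi0 (a : LF i) : Qk k2 := xorq a.2 (pad k2 (h i a.1)).
pose K c (t a : LF i) : C := ((phi0 a == t) && (chi0 a == c))%:R.
have cK (a b : LF i) : \sum_c \sum_t Num.conj (K c t a) * K c t b = (a == b)%:R.
  apply: classical_complete => -[a1 a2] [b1 b2]; rewrite /phi0 /chi0 /= => -[-> e].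
  by congr (_, _); rewrite -[LHS](xorqK _ (pad k2 (h i b1))) e xorqK.
pose F (c : Qk k2) l (u : LF l) : LF l := if l == j then (u.1, xorq u.2 c) else u.
have Fb c l : bijective (F c l).
  by exists (F c l) => -[u1 u2]; rewrite /F; case: (l == j) => //=; rewrite xorqK.
have hr l : l != i -> exists2 f : LF l -> LF l, bijective f & forall a b, (a == b) = (f a == b).
  by move=> _; exists id => //; exists id.
have loF := LOCC_local cK hr (fun c => LOCC_relabel R (Fb c)).
have loJ := LOCC_prerelabel (@join_copies_bij m L N n2) loT.
have lo := LOCC_comp loJ loF.
exists LF, (pairL J QL), h', g'; eexists; split; first exact: lo.
- move=> l [a w] [a' w']; rewrite /h' /g' /=; case: (eqVneq l j) => [e|lj].
    have lS : l \notin S by rewrite e.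
    by move=> -[e1 /(gI _ lS) -> e2]; congr (_, _); apply: pad_rest_inj e1 e2.
  by move=> -[e1 e2 ->]; congr (_, _); apply: hgI; rewrite e1 e2.
- move=> l; rewrite finset.in_setU1 negb_or => /andP[lj lS] [a w] [a' w'].
  by rewrite /g' (negPf lj) /= => -[/(gI _ lS) -> ->].
cbv beta; rewrite tensor_pow_join LamTE.
set t1 := Lam1 _; set t2 := Lam2 _; pose s := tens t1 t2.
have ps : psd s by rewrite /s -LamTE; apply: (LOCC_psd loT); rewrite -tensor_pow_join;
  apply: psd_relabel; [apply: relabel_bij => l; exact: join_copies_bij | exact: tensor_pow_psd].
rewrite [X in class_sum _ _ X](_ : _ = fun y y' => \sum_x conj_by (fun y z => ((phi z == y) && (chi z == x))%:R) s y y'); last first.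
  apply/funext => y; apply/funext => y'; apply: eq_bigr => c _.
  have eK (u z : Joint LF) : K c (relabel (F c) u i) (z i) *
      [forall l, (l != i) ==> (relabel (F c) u l == z l)]%:R = ((phi z == u) && (chi z == c))%:R.
    rewrite /K -natrM mulnb; congr (nat_of_bool _)%:R.
    apply/andP/andP => [[/andP[/eqP e1 e2] /forallP H]|[/eqP <- e2]]; split=> //.
    - apply/eqP/ffunP => l; rewrite ffunE; have [->|li] := eqVneq l i.
        by move: e1; rewrite ffunE /F (negPf ij).
      have := H l; rewrite li /= ffunE /F => /eqP <-; case: eqP => [->|//].
      by rewrite /= -(eqP e2) /chi /chi0 xorqK -surjective_pairing.
    - by rewrite /chi in e2 *; rewrite e2 andbT !ffunE eqxx /F (negPf ij).
    - apply/forallP => l; apply/implyP => li; rewrite !ffunE (negPf li) /F.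
      by case: (l == j) => //=; rewrite (eqP e2) xorqK -surjective_pairing.
  by rewrite /conj_by; apply: eq_bigr => z _; apply: eq_bigr => z' _; rewrite !eK.
rewrite class_sum_push.
pose A1 (z : Joint LF) := agree h S (fstJ z) && (sndJ z i == sndJ z j).
pose key1 (z : Joint LF) := (relabel g (fstJ z), epr_key i j (sndJ z)).
pose A2 (z : Joint LF) := agree h' (j |: S) (phi z).
pose key2 (z : Joint LF) := (relabel g' (phi z), chi z).
(* [B] says that j's surplus bits are 0, as they are after a perfect fusion. With it the input
   condition [A1] becomes equivalent to the output condition [A2]; since it reads only the key,
   [class_sum_sub] can drop it afterwards. *)
pose B (kc : Joint (pairL J QL) * Qk k2) := (kc.1 j).2 == zeroq k2.
have chiE (z : Joint LF) : (z i).2 = (z j).2 -> xorq (z j).2 (chi z) = pad k2 (h i (z i).1).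
  by move=> e; rewrite /chi e [xorq (z j).2 (pad _ _)]xorqC xorqC xorqK.
have phij (z : Joint LF) : phi z j = ((z j).1, xorq (z j).2 (chi z)).
  by rewrite ffunE eq_sym (negPf ij) eqxx.
have phi1 (z : Joint LF) l : (phi z l).1 = (z l).1.
  by rewrite ffunE; case: (l == i) => //; case: (l == j).
have eA z : A1 z = A2 z && B (key2 z).
  have -> : B (key2 z) = (rest k (xorq (z j).2 (chi z)) == zeroq k2).
    by rewrite /B /key2 /= ffunE /g' eqxx phij.
  have h'j : h' j (phi z j) = pad k (xorq (z j).2 (chi z)) by rewrite /h' eqxx phij.
  have h'S l : l \in S -> h' l (phi z l) = h l (z l).1.
    by move=> lS; rewrite /h' phi1; case: eqP => // e; rewrite -e lS in jS.
  rewrite /A1 !ffunE /=; apply/andP/andP => [[/agreeP H /eqP e]|[/agreeP H /eqP e]].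
    have x := chiE _ e; split; last by rewrite /rest x (padK _ le_k) xorq_eq0.
    have hj l : l \in S -> h' l (phi z l) = h' j (phi z j).
      by move=> lS; rewrite h'S // h'j x (padK _ le_k); have := H l i lS iS; rewrite !ffunE.
    apply/agreeP => a b; rewrite !finset.in_setU1 => /orP[/eqP ->|aS] /orP[/eqP ->|bS] //.
    - by rewrite hj.
    - by rewrite hj.
    - by rewrite !hj.
  have e1 : pad k (xorq (z j).2 (chi z)) = h i (z i).1.
    by rewrite -h'j -h'S //; apply: H; rewrite finset.in_setU1 ?eqxx ?iS ?orbT.
  split.
    apply/agreeP => a b aS bS; rewrite !ffunE -!h'S //.
    by apply: H; rewrite finset.in_setU1 ?aS ?bS orbT.
  move/eqP: e; rewrite /rest e1 xorq_eq0 => /eqP e.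
  have := congr1 (fun x => xorq x (chi z)) e; rewrite xorqK => ->.
  by rewrite /chi xorqC xorqK.
(* On [A1] the two components changed by [phi] add nothing to the output key: i's half is 0 and so
   are j's surplus bits. Hence the output key holds the same information as the input key with the
   outcome. *)
have ekey z z' : A1 z -> A1 z' -> ((key1 z, chi z) == (key1 z', chi z')) = (key2 z == key2 z').
  move=> /andP[_ /eqP az] /andP[_ /eqP az']; rewrite !ffunE in az az'.
  rewrite /key1 /key2 !xpair_eqE; case: (chi z =P chi z') => ec; rewrite ?andbT ?andbF //.
  apply/andP/eqP => [[/eqP/ffunP e1 /eqP/ffunP e2]|/ffunP H].
    apply/ffunP => l; rewrite !ffunE /g'; congr (_, _).
      by have := e1 l; rewrite !ffunE; case: (l == i) => //; case: (l == j).
    have := e2 l; rewrite !ffunE; have [->|li] := eqVneq l i; first by rewrite (negPf ij).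
    have [->|lj //] := eqVneq l j; rewrite /= !chiE //.
    have r0 (q : Qk k) : rest k (pad k2 q) = zeroq k2 by apply/eqP; rewrite /rest (padK _ le_k) xorq_eq0.
    by rewrite !r0.
  split; apply/eqP/ffunP => l; have := H l; rewrite !ffunE /g'.
    by move=> -[]; case: (l == i) => //; case: (l == j).
  have [->|li] := eqVneq l i => //=.
  by have [->|lj] := eqVneq l j => //= -[].
have key : class_sum A1 key1 s <= (2 ^+ k2) * class_sum A2 key2 s.
  apply: (le_trans (class_sum_split A1 key1 chi ps)).
  rewrite card_Qk natrX ler_pM2l ?exprn_gt0 //.
  have -> : class_sum A1 (fun z => (key1 z, chi z)) s = class_sum (fun z => A2 z && B (key2 z)) key2 s.
    apply: eq_class_sum => z z'; rewrite -!eA.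
    case a: (A1 z) => //=; case a': (A1 z') => //=; exact: ekey.
  exact: class_sum_sub.
have p0 n : (0 : C) < (2 ^+ n)^-1 by rewrite invr_gt0 exprn_gt0.
apply: (le_trans (ler_pM v1_0 v2_0 v1P v2P)).
rewrite mulrACA class_sum_tens -/s -mulrA ler_pM2l //.
by rewrite ler_pdivrMl ?exprn_gt0.
Qed.

(** The parties in [ps] have measured their remainders, forgotten the outcomes and kept only their
    registers. The key already separates different remainders, so these measurements leave the class
    sum unchanged. *)
Lemma shares_discard L (rho : op R (Joint L)) k N (v : C) (ps : seq 'I_m) :
  shares rho finset.setT k N v ->
  exists Lf J (h : forall i, Lf i -> Qk k) (g : forall i, Lf i -> J i)
    (Lam : op R (Joint (Lcopies L N)) -> op R (Joint Lf)),
  [/\ LOCC Lam, forall i, injective (fun a => (h i a, g i a)),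
      forall i, i \in ps -> bijective (h i) /\ forall a b, g i a = g i b &
      v <= (2 ^+ k)^-1 * class_sum (agree h finset.setT) (relabel g) (Lam (tensor_pow (n := N) rho))].
Proof.
move=> sh; elim: ps => [|p ps [Lf [J [h [g [Lam [lo hgI gps vP]]]]]]].
  by have [Lf [J [h [g [Lam [lo hgI _ vP]]]]]] := sh; exists Lf, J, h, g, Lam.
pose Q := Qk k.
pose LF := upd Lf p Q.
pose u i : Lf i -> LF i := match i == p as b return
    Finite.sort (Lf i) -> Finite.sort (if b then Q else Lf i) with
  | true => h i | false => id end.
pose h' i : LF i -> Q := match i == p as b return
    Finite.sort (if b then Q else Lf i) -> Q with
  | true => id | false => h i end.
(* [None] is the constant remainder of a party that has discarded. *)
pose g' i : LF i -> option (J i) := match i == p as b return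
    Finite.sort (if b then Q else Lf i) -> option (J i) with
  | true => fun=> None | false => fun a => Some (g i a) end.
have h'u i a : h' i (u i a) = h i a by rewrite /h' /u /LF /upd; case: (i == p).
have g'u i a : g' i (u i a) = if i == p then None else Some (g i a).
  by rewrite /g' /u /LF /upd; case: (i == p).
pose phi (z : Joint Lf) : Joint LF := [ffun i => u i (z i)].
pose chi (z : Joint Lf) := g p (z p).
pose K (x : J p) (t : Q) (a : Lf p) : C := ((h p a == t) && (g p a == x))%:R.
have cK : forall a b, \sum_x \sum_t Num.conj (K x t a) * K x t b = (a == b)%:R.
  exact: classical_complete.
have lid (x : J p) : LOCC (fun (rho : op R (Joint LF)) y y' =>
     rho (relabel (fun i => @id (LF i)) y) (relabel (fun i => @id (LF i)) y')).
  by apply: LOCC_relabel => i; exists id.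
have lo' := LOCC_comp lo (LOCC_step cK lid).
exists LF, (fun i => option (J i) : finType), h', g'; eexists; split; first exact: lo'.
- move=> i; rewrite /h' /g' /LF /upd; case: (i == p); first by move=> a b [].
  by move=> a b [e1 e2]; apply: hgI; rewrite e1 e2.
- move=> i; rewrite inE; rewrite /h' /g' /LF /upd; case: (i == p) => /=.
    by move=> _; split=> //; exists id.
  by move=> /gps[hb gc]; split=> // a b; rewrite (gc a b).
cbv beta; set s := Lam _ in vP *.
rewrite [X in class_sum _ _ X](_ : _ = fun y y' => \sum_x conj_by (fun y z => ((phi z == y) && (chi z == x))%:R) s y y'); last first.
  apply/funext => y; apply/funext => y'; apply: eq_bigr => x _.
  have idJ (z : Joint LF) : relabel (fun i => @id (LF i)) z = z by apply/ffunP => i; rewrite ffunE.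
  have eK (w : Joint LF) (z : Joint Lf) : Defs.liftK (K x) w z = ((phi z == w) && (chi z == x))%:R.
    have -> : (phi z == w) = [forall i, u i (z i) == w i].
      apply/eqP/forallP => [<- i|H]; first by rewrite ffunE.
      by apply/ffunP => i; rewrite ffunE; apply/eqP.
    have eu i : i != p -> (u i (z i) == w i) = cmp_old (w i) (z i).
      rewrite /u /cmp_old; move: (w i); rewrite /LF /upd.
      by case: (i == p) => //= a _; rewrite eq_sym.
    have ep : (if get_new w is Some t then K x t (z p) else 0) = ((u p (z p) == w p) && (chi z == x))%:R.
      have gen b (e : (p == p) = b) (a : Lf p) (c : if b then Q else Lf p) :
        (if (match b as b return Finite.sort (if b then Q else Lf p) -> option Q with
           | true => fun z => Some z | false => fun _ => None end) c is Some t then K x t a else 0) =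
        (((match b as b return
            Finite.sort (Lf p) -> Finite.sort (if b then Q else Lf p) with
          | true => h p | false => id end) a == c) && (g p a == x))%:R.
        by case: b e c => // ; rewrite eqxx.
      exact: gen.
    rewrite /Defs.liftK ep -natrM mulnb; congr (nat_of_bool _)%:R.
    apply/andP/andP => [[/andP[e1 e2] /forallP H]|[/forallP H ->]]; split=> //.
    - apply/forallP => i; have [->//|ip] := eqVneq i p.
      by rewrite eu //; have := H i; rewrite ip.
    - by rewrite H.
    - by apply/forallP => i; apply/implyP => ip; rewrite -eu.
  by rewrite !idJ; apply: eq_bigr => z _; apply: eq_bigr => z' _; rewrite !eK.
rewrite class_sum_push; apply: (le_trans vP); rewrite ler_pM2l ?invr_gt0 ?exprn_gt0 //.
rewrite le_eqVlt; apply/orP; left; apply/eqP/eq_class_sum => z z'.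
have eA w : agree h' finset.setT (phi w) = agree h finset.setT w.
  by apply/agreeP/agreeP => H i j _ _; have := H i j (finset.in_setT _) (finset.in_setT _);
    rewrite !ffunE !h'u.
rewrite !eA; congr [&& _, _ & _]; rewrite xpair_eqE.
apply/eqP/andP => [e|[/eqP/ffunP e /eqP e']].
  have e1 i : g i (z i) = g i (z' i) by have /ffunP/(_ i) := e; rewrite !ffunE.
  by split; apply/eqP; rewrite /chi ?e1 //; apply/ffunP => i; rewrite !ffunE !g'u e1.
apply/ffunP => i; rewrite !ffunE; have [->//|ip] := eqVneq i p.
by have := e i; rewrite !ffunE !g'u (negPf ip) => -[].
Qed.

(** After all parties have discarded, the maps [h] are bijections and only have to be inverted by a
    local relabelling to give plain qubits. *)
Lemma shares_ghz L (rho : op R (Joint L)) k N (v : C) :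
  shares rho finset.setT k N v ->
  exists2 Lam : op R (Joint (Lcopies L N)) -> op R (Joint (Lqubits k)),
    LOCC Lam & v <= (2 ^+ k)^-1 *
      class_sum (agree (fun i (a : Lqubits k i) => a : Qk k) finset.setT) (fun=> tt) (Lam (tensor_pow (n := N) rho)).
Proof.
move=> /(shares_discard (enum 'I_m)) [Lf [J [h [g [Lam [lo _ hg vP]]]]]].
have hb i : bijective (h i) by have [] := hg i (mem_enum _ i).
have gc i a b : g i a = g i b by have [_] := hg i (mem_enum _ i); apply.
have {hb} [f fP] : exists f : forall i, Qk k -> Lf i, forall i, cancel (f i) (h i) /\ bijective (f i).
  have ex i : exists f : Qk k -> Lf i, cancel f (h i) /\ bijective f.
    by have [f hf fh] := hb i; exists f; split=> //; exists (h i).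
  by exists (fun i => projT1 (cid (ex i))) => i; exact: (projT2 (cid (ex i))).
pose F i : Lqubits (m := m) k i -> Lf i := f i.
have Fb i : bijective (F i) by have [] := fP i.
exists (fun s y y' => Lam s (relabel F y) (relabel F y')).
  exact: (LOCC_comp lo (LOCC_relabel R Fb)).
apply: (le_trans vP); rewrite ler_pM2l ?invr_gt0 ?exprn_gt0 //.
rewrite -(class_sum_reindex _ _ _ (relabel_bij Fb)); rewrite le_eqVlt; apply/orP; left; apply/eqP/eq_class_sum => z z'.
have eA w : agree h finset.setT (relabel F w) = agree (fun i (a : Lqubits (m := m) k i) => a : Qk k) finset.setT w.
  have e i : h i (F i (w i)) = w i by have [fh _] := fP i; rewrite /F fh.
  by apply/agreeP/agreeP => H i j _ _; have := H i j (finset.in_setT _) (finset.in_setT _);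
    rewrite !ffunE !e.
have e : relabel g (relabel F z) = relabel g (relabel F z').
  by apply/ffunP => i; rewrite !ffunE; exact: gc.
by rewrite !eA e !eqxx.
Qed.

End Shares.

(** * GHZ and EPR fidelities as class sums *)

Section Targets.
Variables (R : realType) (m : nat).
Local Notation C := (R[i]).

Lemma sform_indicator (T : finType) (A : pred T) (c : C) (s : op R T) :
  sform s (fun x => (A x)%:R * c) (fun x => (A x)%:R * c) =
  (Num.conj c * c) * class_sum A (fun=> tt) s.
Proof.
rewrite /sform /class_sum mulr_sumr; apply: eq_bigr => x _.
rewrite mulr_sumr; apply: eq_bigr => y _.
by rewrite eqxx andbT -mulnb natrM rmorphM /= conjC_nat; ring.
Qed.

Lemma sqrtC2_pow k (c : C) : c = (sqrtC 2)^-1 ^+ k -> Num.conj c * c = (2 ^+ k)^-1.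
Proof.
move=> ->; have c0 : 0 <= (sqrtC 2 : C)^-1 ^+ k by rewrite exprn_ge0 // invr_ge0 sqrtC_ge0.
have -> : Num.conj ((sqrtC 2 : C)^-1 ^+ k) = (sqrtC 2)^-1 ^+ k by apply/CrealP/ger0_real.
by rewrite -exprMn -expr2 exprVn sqrtCK exprVn.
Qed.

Lemma prod_if (k : nat) (c : C) (P : 'I_k -> bool) :
  \prod_(t < k) (if P t then c else 0) = [forall t, P t]%:R * c ^+ k.
Proof.
case: (boolP [forall t, P t]) => [/forallP H|].
  rewrite mul1r (eq_bigr (fun=> c)) ?prodr_const ?card_ord // => t _.
  by rewrite H.
rewrite negb_forall => /existsP[t /negPf Pt].
by rewrite mul0r (bigD1 t) //= Pt mul0r.
Qed.

Definition agree_all k : pred (Joint (Lqubits (m := m) k)) :=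
  agree (fun i (a : Lqubits k i) => a : Qk k) finset.setT.

Lemma ghz_ketE k (z : Joint (Lqubits (m := m) k)) :
  ghz_ket R z = (agree_all z)%:R * (sqrtC 2)^-1 ^+ k.
Proof.
rewrite /ghz_ket prod_if; congr ((nat_of_bool _)%:R * _).
apply/forallP/agreeP => [H i j _ _|H t].
  by apply/ffunP => t; have /forallP/(_ i)/forallP/(_ j)/eqP := H t.
by apply/forallP => i; apply/forallP => j; rewrite (H i j (finset.in_setT _) (finset.in_setT _)).
Qed.

Lemma epr_ketE k (ab : Q2 k) : epr_ket R ab = (ab.1 == ab.2)%:R * (sqrtC 2)^-1 ^+ k.
Proof.
rewrite /epr_ket prod_if; congr ((nat_of_bool _)%:R * _).
apply/forallP/eqP => [H|-> //]; by apply/ffunP => t; apply/eqP.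
Qed.

Lemma vnorm2_indicator (T : finType) (A : pred T) k :
  \sum_x (A x)%:R = (2 ^ k)%:R :> C ->
  vnorm2 (fun x => (A x)%:R * (sqrtC 2 : C)^-1 ^+ k) = 1.
Proof.
move=> sA; rewrite /vnorm2.
transitivity (\sum_x (A x)%:R * (2 ^+ k)^-1 : C).
  apply: eq_bigr => x _; rewrite normCK rmorphM /= conjC_nat.
  rewrite mulrACA -natrM mulnb andbb mulrC [X in X * _]mulrC (sqrtC2_pow (erefl _)).
  by rewrite mulrC.
by rewrite -mulr_suml sA natrX mulfV // expf_neq0 // pnatr_eq0.
Qed.
End Targets.
Section Fidelities.
Variables (R : realType) (m : nat).
Local Notation C := (R[i]).

Lemma ghz_fidelity k (s : op R (Joint (Lqubits (m := m) k))) : (0 < m)%N -> psd s ->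
  0 <= fidelity (@ghz_state R m k) s /\
  ((fidelity (@ghz_state R m k) s) ^+ 2)%:C%C =
  (2 ^+ k)^-1 * class_sum (@agree_all m k) (fun=> tt) s.
Proof.
move=> m0 ps; pose i0 : 'I_m := Ordinal m0.
have fE : @ghz_ket R m k = fun z => (agree_all z)%:R * (sqrtC 2)^-1 ^+ k.
  by apply/funext => z; rewrite ghz_ketE.
have [|F0 FE] := @fidelity_pure R _ (@ghz_ket R m k) s _ ps.
  rewrite fE; apply: vnorm2_indicator.
  pose F (q : Qk k) : Joint (Lqubits (m := m) k) := [ffun=> q].
  transitivity (\sum_(z : Joint (Lqubits (m := m) k)) \sum_q (q == z i0)%:R * (z == F q)%:R : C).
    apply: eq_bigr => z _; rewrite sum_pick; congr (nat_of_bool _)%:R.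
    apply/agreeP/eqP => [H|-> i j _ _]; last by rewrite !ffunE.
    by apply/ffunP => i; rewrite ffunE; apply: H; exact: finset.in_setT.
  rewrite exchange_big /= -card_Qk -sum1_card natr_sum; apply: eq_bigr => q _.
  by rewrite sum_pickr ffunE eqxx.
by split=> //; rewrite FE fE sform_indicator (sqrtC2_pow (erefl _)).
Qed.

(** The partial trace in Kraus form: all parties but i and j are measured in the basis and the
    outcome is forgotten. This gives both positivity and access to [class_sum_push]. *)
Lemma reduce2_push k i j (s : op R (Joint (Lqubits (m := m) k))) :
  reduce2 i j s = fun y y' => \sum_x
    conj_by (fun y (z : Joint (Lqubits k)) => (((z i, z j) == y) && (epr_key i j z == x))%:R) s y y'.
Proof.
apply/funext => ab; apply/funext => ab'; rewrite /reduce2 /conj_by.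
rewrite [RHS]exchange_big /=; apply: eq_bigr => z _.
rewrite [RHS]exchange_big /=; apply: eq_bigr => z' _.
transitivity (\sum_x (x == epr_key i j z)%:R * ((((z i, z j) == ab)%:R * ((z' i, z' j) == ab')%:R *
   (epr_key i j z' == x)%:R) * s z z')); last first.
  apply: eq_bigr => x _; rewrite conjC_nat -!mulnb !natrM [x == _]eq_sym; ring.
rewrite sum_pick; congr (_ * _); rewrite -!natrM !mulnb; congr (nat_of_bool _)%:R.
case: ab ab' => [a b] [a' b']; rewrite !xpair_eqE /= -!andbA; do 4!congr (_ && _).
apply/forallP/eqP => [H|/ffunP H l].
  apply/ffunP => l; rewrite !ffunE; have := H l; rewrite -negb_or.
  by case: (_ || _) => //= /eqP.
rewrite -negb_or; have := H l; rewrite !ffunE.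
by case: (_ || _) => //= ->.
Qed.

Lemma epr_fidelity k i j (s : op R (Joint (Lqubits (m := m) k))) : psd s ->
  0 <= fidelity (@epr_state R k) (reduce2 i j s) /\
  ((fidelity (@epr_state R k) (reduce2 i j s)) ^+ 2)%:C%C =
  (2 ^+ k)^-1 * class_sum (fun w : Joint (Lqubits k) => w i == w j) (epr_key i j) s.
Proof.
move=> ps.
have fE : @epr_ket R k = fun ab => (ab.1 == ab.2)%:R * (sqrtC 2)^-1 ^+ k.
  by apply/funext => z; rewrite epr_ketE.
have [||F0 FE] := @fidelity_pure R _ (@epr_ket R k) (reduce2 i j s).
- rewrite fE; apply: vnorm2_indicator.
  rewrite -(pair_bigA _ (fun a b : Qk k => (a == b)%:R : C)) /=.
  rewrite -card_Qk -sum1_card natr_sum; apply: eq_bigr => a _.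
  rewrite -[RHS](sum_pick a (fun=> 1)); apply: eq_bigr => b _.
  by rewrite mulr1 eq_sym.
- by rewrite reduce2_push; apply: psd_sum => x; apply: psd_conj_by.
split=> //; rewrite FE fE sform_indicator (sqrtC2_pow (erefl _)); congr (_ * _).
rewrite reduce2_push class_sum_push; apply: eq_class_sum => z z'.
by rewrite xpair_eqE eqxx.
Qed.

Lemma epr_key_sym k i j : @epr_key m k i j = epr_key j i.
Proof. by apply/funext => w; apply/ffunP => l; rewrite !ffunE orbC. Qed.

End Fidelities.

(** * Protocol along a spanning tree *)

Section Growth.
Variables (R : realType) (m : nat).
Local Notation C := (R[i]).

Lemma shares_ghz_protocol (L : 'I_m -> finType) (rho : op R (Joint L)) k N (v : R) :
  (0 < m)%N -> psd rho -> 0 <= v -> shares rho finset.setT k N (v ^+ 2)%:C%C ->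
  ghz_protocol rho N k (1 - v).
Proof.
move=> m0 prho v0 /shares_ghz[Lam lo vP]; exists Lam; split=> //.
have [F0 FE] := ghz_fidelity m0 (LOCC_psd lo (tensor_pow_psd (n := N) prho)).
by rewrite opprB addrC subrK -(ler_pXn2r (n := 2)) ?nnegrE // -lecR FE.
Qed.

Lemma connect_crossing (T : finType) (e : rel T) (S : {set T}) x y :
  connect e x y -> x \in S -> y \notin S -> exists a b, [/\ a \in S, b \notin S & e a b].
Proof.
move=> /connectP[p]; elim: p x => [|z p IH] x /=; first by move=> _ -> ->.
move=> /andP[xz zp] ylast xS yS; case: (boolP (z \in S)) => zS; last by exists x, z.
exact: IH zp ylast zS yS.
Qed.

(** The error bounds are arbitrary reals, so the edge factors [f] are kept in [0, 1]: they can then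
    be squared monotonically, and extra factors only weaken the claim. *)
Lemma tree_protocol (L : 'I_m -> finType) (rho : op R (Joint L))
    (E : {set 'I_m * 'I_m}) (N k2 : 'I_m * 'I_m -> nat) (eps f : 'I_m * 'I_m -> R) (k n : nat) :
  (0 < m)%N -> density rho -> (forall u v, connect (adjE E) u v) ->
  (forall e, e \in E -> epr_protocol rho e.1 e.2 (N e) (k2 e) (eps e)) ->
  (forall e, e \in E -> (k <= k2 e)%N) ->
  (forall e, 0 <= f e <= 1) -> (forall e, e \in E -> f e <= Num.max 0 (1 - eps e)) ->
  (\sum_(e in E) N e <= n)%N ->
  ghz_protocol rho n k (1 - \prod_(e in E) f e).
Proof.
move=> m0 [prho trho] conn prot kk2 f01 feps Nn.
have f0 e : 0 <= f e by have /andP[] := f01 e.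
have f1 e : f e <= 1 by have /andP[] := f01 e.
pose r : 'I_m := Ordinal m0.
(* U collects the edges used so far. The free number N' of additional copies, available already for
   a single party, later absorbs the copies left over from n. *)
have grow s : (s < m)%N -> exists (S : {set 'I_m}) (U : {set 'I_m * 'I_m}),
  [/\ r \in S, #|S| = s.+1, U \subset E, forall e, e \in U -> (e.1 \in S) && (e.2 \in S) &
    forall N', shares rho S k (N' + \sum_(e in U) N e) ((\prod_(e in U) f e) ^+ 2)%:C%C].
  elim: s => [_|s IH sm].
    exists [set r]%SET, finset.set0; split.
    - by rewrite finset.in_set1.
    - by rewrite cards1.
    - exact: finset.sub0set.
    - by move=> e; rewrite finset.in_set0.
    - by move=> N'; rewrite !big_set0 expr1n; apply: shares_singleton.
  have [S [U [rS cS UE US sh]]] := IH (ltnW sm).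
  have [y yS] : exists y, y \notin S.
    apply/existsP; apply: contraTT sm; rewrite negb_exists => /forallP H.
    have : [set: 'I_m]%SET \subset S by apply/fintype.subsetP => z _; have := H z; rewrite negbK.
    by move/subset_leq_card; rewrite cardsT card_ord cS -leqNgt.
  have [a [b [aS bS ab]]] := connect_crossing (conn r y) rS yS.
  have [e [eE eab]] : exists e, e \in E /\ (e = (a, b) \/ e = (b, a)).
    by case/orP: ab => h; [exists (a, b)|exists (b, a)]; split=> //; [left|right].
  (* The new edge crosses the boundary of S, whereas edges of U lie inside S. *)
  have eU : e \notin U.
    apply/negP => /US; case: eab => -> /=; rewrite (negPf bS) ?andbF //.
  exists (b |: S)%SET, (e |: U)%SET; split.
  - by rewrite finset.in_setU1 rS orbT.
  - by rewrite cardsU1 bS cS.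
  - by rewrite finset.subUset finset.sub1set eE.
  - move=> e'; rewrite finset.in_setU1 => /orP[/eqP ->|/US /andP[x1 x2]].
      by case: eab => -> /=; rewrite !finset.in_setU1 eqxx aS ?orbT.
    by rewrite !finset.in_setU1 x1 x2 !orbT.
  move=> N'; rewrite !big_setU1 //= addnCA addnC.
  have [Lam [lo F1]] := prot e eE.
  have [F0 FE] := epr_fidelity e.1 e.2 (LOCC_psd lo (tensor_pow_psd (n := N e) prho)).
  rewrite mulrC exprMn rmorphM /=.
  apply: (shares_fuse prho aS bS (kk2 e eE) _ _ (sh N') lo).
  - by rewrite ler0c exprn_ge0 // prodr_ge0.
  - by rewrite ler0c exprn_ge0.
  (* Growth may traverse an edge against its stored orientation; the EPR overlap is symmetric in the
     two ends. *)
  have -> : (fun w : Joint (Lqubits (m := m) (k2 e)) => w a == w b) = (fun w => w e.1 == w e.2).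
    by case: eab => -> //=; apply/funext => w; rewrite eq_sym.
  have -> : @epr_key m (k2 e) a b = epr_key e.1 e.2 by case: eab => -> //=; rewrite epr_key_sym.
  rewrite -FE lecR ler_pXn2r ?nnegrE //.
  by apply: (le_trans (feps e eE)); rewrite ge_max F0.
have m1 : (m.-1 < m)%N by rewrite prednK.
have [S [U [rS cS UE US sh]]] := grow _ m1.
have ST : S = finset.setT.
  by apply/eqP; rewrite eqEcard finset.subsetT cardsT card_ord cS prednK /=.
subst S.
have UN : (\sum_(e in U) N e <= n)%N.
  apply: leq_trans Nn; rewrite [X in (_ <= X)%N](bigID (mem U)) /=.
  rewrite [X in (_ <= X + _)%N](eq_bigl (mem U)); first exact: leq_addr.
  by move=> e; rewrite -finset.in_setI; have /finset.setIidPr -> := UE.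
have := sh (n - \sum_(e in U) N e)%N; rewrite subnK // => /shares_ghz_protocol.
have p0 : 0 <= \prod_(e in U) f e by apply: prodr_ge0.
move=> /(_ m0 prho p0) [Lam [lo H]].
exists Lam; split=> //; apply: le_trans H; rewrite !(lerD2l, lerN2).
rewrite [leLHS](bigID (mem U)) /= [X in X * _](eq_bigl (mem U)); last first.
  by move=> e; rewrite -finset.in_setI; have /finset.setIidPr -> := UE.
by rewrite ler_piMr ?prodr_ge0 // prodr_ile1.
Qed.

(** Rate 0 is thereby always achievable, so both suprema are nonnegative. For k = 0 the protocol of
    a single party serves all parties, since empty strings always agree. *)
Lemma trivial_protocols (L : 'I_m -> finType) (rho : op R (Joint L)) n :
  (0 < m)%N -> density rho ->
  ghz_protocol rho n 0 0 /\ forall i j, epr_protocol rho i j n 0 0.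
Proof.
move=> m0 [prho trho].
have sh : shares rho finset.setT 0 n 1.
  have [Lf [J [h [g [Lam [lo hgI gI vP]]]]]] := shares_singleton (Ordinal m0) 0 n trho.
  exists Lf, J, h, g, Lam; split=> //; first by move=> i; rewrite finset.in_setT.
  apply: (le_trans vP); rewrite le_eqVlt; apply/orP; left; apply/eqP; congr (_ * _).
  have q0 (a b : Qk 0) : a = b by apply/ffunP => -[].
  have ag T z : agree h T z by apply/agreeP => i j _ _; exact: q0.
  by apply: eq_class_sum => z z'; rewrite !ag.
split.
  by have := shares_ghz_protocol m0 prho (@ler01 R); rewrite expr1n subrr; apply; exact: sh.
move=> i j; have [Lam lo vP] := shares_ghz sh; exists Lam; split=> //.
have [F0 FE] := epr_fidelity i j (LOCC_psd lo (tensor_pow_psd (n := n) prho)).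
rewrite subr0 -(ler_pXn2r (n := 2)) ?nnegrE // -lecR FE expr1n.
apply: (le_trans vP); rewrite le_eqVlt; apply/orP; left; apply/eqP; congr (_ * _).
have J0 (z z' : Joint (Lqubits (m := m) 0)) : z = z' by apply/ffunP => l; apply/ffunP => -[].
apply: eq_class_sum => z z'; rewrite (J0 z' z) !eqxx !andbT.
have -> : agree (fun i (a : Lqubits (m := m) 0 i) => a : Qk 0) finset.setT z.
  by apply/agreeP => ? ? _ _; apply/ffunP => -[].
by symmetry; rewrite andbb; apply/eqP/ffunP => -[].
Qed.

End Growth.

(** * Rates *)

Section Analysis.
Variable R : realType.

Lemma cvg_minr (u v : nat -> R) (a b : R) :
  u @ \oo --> a -> v @ \oo --> b -> (fun n => Num.min (u n) (v n)) @ \oo --> Num.min a b.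
Proof.
move=> ua vb; rewrite minr_absE.
have -> : (fun n => Num.min (u n) (v n)) = fun n => (u n + v n - `|u n - v n|) / 2%:R.
  by apply/funext => n; rewrite minr_absE.
by apply: cvgMl; apply: cvgB; [apply: cvgD|apply: cvg_norm; apply: cvgB].
Qed.

Lemma cvg_bigmin (I : Type) (s : seq I) (P : pred I) (u0 : nat -> nat) (u : I -> nat -> nat) (r : R) :
  (fun n => (u0 n)%:R / n%:R : R) @ \oo --> r ->
  (forall i, P i -> (fun n => (u i n)%:R / n%:R : R) @ \oo --> r) ->
  (fun n => (\big[minn/u0 n]_(i <- s | P i) u i n)%:R / n%:R : R) @ \oo --> r.
Proof.
move=> h0 h; elim: s => [|i s IH].
  by under eq_fun => n do rewrite big_nil.
rewrite (_ : (fun n => _) = fun n => if P i then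
    Num.min ((u i n)%:R / n%:R) ((\big[minn/u0 n]_(j <- s | P j) u j n)%:R / n%:R) else
    (\big[minn/u0 n]_(j <- s | P j) u j n)%:R / n%:R); last first.
  apply/funext => n; rewrite big_cons; case: ifP => // _.
  by rewrite -minr_pMl ?invr_ge0 // natr_min.
case Pi: (P i) => //; rewrite -[X in _ --> X]minxx; apply: cvg_minr => //; exact: h.
Qed.

Lemma cvg_bigprod (I : Type) (s : seq I) (P : pred I) (u : I -> nat -> R) :
  (forall i, P i -> u i @ \oo --> (1 : R)) ->
  (fun n => \prod_(i <- s | P i) u i n) @ \oo --> (1 : R).
Proof.
move=> h; elim: s => [|i s IH].
  by under eq_fun => n do rewrite big_nil; exact: cvg_cst.
rewrite (_ : (fun n => _) = fun n => if P i then
    u i n * \prod_(j <- s | P j) u j n else \prod_(j <- s | P j) u j n); last first.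
  by apply/funext => n; rewrite big_cons.
case Pi: (P i) => //; rewrite -[X in _ --> X]mulr1; apply: cvgM => //; exact: h.
Qed.

Lemma bigmin_leq (I : eqType) (s : seq I) (P : pred I) (n0 : nat) (u : I -> nat) i :
  i \in s -> P i -> (\big[minn/n0]_(j <- s | P j) u j <= u i)%N.
Proof.
elim: s => // j s IH; rewrite inE big_cons => /orP[/eqP <- ->|js Pi]; first exact: geq_minl.
by case: ifP => _; [rewrite geq_min IH ?orbT|exact: IH].
Qed.

Lemma cvg_truncn (t : R) : 0 <= t ->
  (fun n => (Num.truncn (t * n%:R))%:R / n%:R : R) @ \oo --> t.
Proof.
move=> t0; apply/cvgrPdist_le => e e0; near=> n.
have n_large : e^-1 <= n%:R by near: n; exact: nbhs_infty_ger.
have n0 : (0 : R) < n%:R by apply: lt_le_trans n_large; rewrite invr_gt0.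
have /truncn_itv/andP[lo hi] : 0 <= t * n%:R by rewrite mulr_ge0.
rewrite ger0_norm; last by rewrite subr_ge0 ler_pdivrMr.
rewrite lerBlDr -(ler_pM2r n0) mulrDl divfK ?gt_eqF //.
apply/ltW/(lt_le_trans hi); rewrite -natr1 addrC lerD2r.
by rewrite -ler_pdivrMl // mulr1.
Unshelve. all: by end_near.
Qed.

Lemma cvg_truncn_infty (t : R) : 0 < t -> (fun n => Num.truncn (t * n%:R)) @ \oo --> \oo.
Proof.
move=> t0; apply/cvgnyPge => A; near=> n.
rewrite truncn_ge_nat ?mulr_ge0 ?(ltW t0) //.
rewrite -ler_pdivrMl //; near: n; exact: nbhs_infty_ger.
Unshelve. all: by end_near.
Qed.

(** With N = [truncn (t * n)], the quotient factors as (k N / N) * (N / n) once N is nonzero, which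
    holds for large n. *)
Lemma cvg_rate (k : nat -> nat) (q t : R) : 0 < t ->
  (fun n => (k n)%:R / n%:R : R) @ \oo --> q ->
  (fun n => (k (Num.truncn (t * n%:R)))%:R / n%:R : R) @ \oo --> q * t.
Proof.
move=> t0 kq; have ninf := cvg_truncn_infty t0.
have h : (fun n => (k (Num.truncn (t * n%:R)))%:R / (Num.truncn (t * n%:R))%:R *
    ((Num.truncn (t * n%:R))%:R / n%:R) : R) @ \oo --> q * t.
  by apply: cvgM; [exact: (cvg_comp _ _ ninf kq)|exact: (cvg_truncn (ltW t0))].
apply: (cvg_trans _ h); apply: near_eq_cvg; near=> n.
have N0 : (Num.truncn (t * n%:R))%:R != 0 :> R.
  rewrite pnatr_eq0 -lt0n; near: n; by have /cvgnyPgt/(_ 0%N) := ninf.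
by rewrite /= mulrA divfK.
Unshelve. all: by end_near.
Qed.

Lemma tree_achievable (m : nat) (L : 'I_m -> finType) (rho : op R (Joint L))
    (E : {set 'I_m * 'I_m}) (q : 'I_m * 'I_m -> R) (r : R) :
  (0 < m)%N -> density rho -> (forall u v, connect (adjE E) u v) ->
  (forall e, e \in E -> 0 < q e /\ achievable (epr_protocol rho e.1 e.2) (q e)) ->
  0 < r -> r * \sum_(e in E) (q e)^-1 <= 1 ->
  achievable (ghz_protocol rho) r.
Proof.
move=> m0 drho conn qE r0 rsum.
have [F FP] : exists F : 'I_m * 'I_m -> (nat -> nat) * (nat -> R), forall e, e \in E ->
   [/\ forall n, epr_protocol rho e.1 e.2 n ((F e).1 n) ((F e).2 n),
     (F e).2 @ \oo --> (0 : R) & (fun n => ((F e).1 n)%:R / n%:R) @ \oo --> q e].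
  have ex e : exists G : (nat -> nat) * (nat -> R), e \in E ->
    [/\ forall n, epr_protocol rho e.1 e.2 n (G.1 n) (G.2 n),
     G.2 @ \oo --> (0 : R) & (fun n => (G.1 n)%:R / n%:R) @ \oo --> q e].
    case: (boolP (e \in E)) => [eE|_]; last by exists (fun=> 0%N, fun=> 0).
    by have [_ [k [eps [h1 [h2 h3]]]]] := qE e eE; exists (k, eps).
  by exists (fun e => projT1 (cid (ex e))) => e; exact: (projT2 (cid (ex e))).
(* The fraction of the n copies given to edge e; the hypothesis on r says that these fractions sum
   to at most 1. *)
pose t e := r / q e.
have t0 e : e \in E -> 0 < t e by move=> /qE[q0 _]; rewrite divr_gt0.
pose N n e := Num.truncn (t e * n%:R).
(* All edges must supply the same number of pairs. The default value of the minimum has rate r as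
   well, so the limit is still r. *)
pose k n := \big[minn/Num.truncn (r * n%:R)]_(e in E) (F e).1 (N n e).
(* Clipping to [0, 1] keeps the limit 1 and meets the requirements of [tree_protocol] even when the
   error bound is negative or exceeds 1. *)
pose f n e : R := Num.max 0 (Num.min 1 (1 - (F e).2 (N n e))).
exists k, (fun n => 1 - \prod_(e in E) f n e); split; last split.
- move=> n; apply: (@tree_protocol R m L rho E (N n) (fun e => (F e).1 (N n e))
    (fun e => (F e).2 (N n e)) (f n)) => //.
  + by move=> e eE; have [h _ _] := FP e eE; exact: h.
  + by move=> e eE; exact: bigmin_leq (mem_index_enum e) eE.
  + move=> e; rewrite /f le_max lexx /= ge_max ler01 ge_min lexx //.
  + move=> e _; rewrite /f ge_max !le_max lexx /= !ge_min lexx !orbT //.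
  + rewrite -(ler_nat R) natr_sum; apply: (@le_trans _ _ (\sum_(e in E) t e * n%:R)).
      apply: ler_sum => e eE; rewrite /N.
      by have /truncn_itv/andP[] : 0 <= t e * n%:R by rewrite mulr_ge0 ?(ltW (t0 e eE)).
    by rewrite -mulr_suml -mulr_sumr ler_piMl.
- rewrite -[X in _ --> X](subrr 1); apply: cvgB; first exact: cvg_cst.
  apply: cvg_bigprod => e eE; have [_ h _] := FP e eE.
  have h1 : (fun n => 1 - (F e).2 (N n e)) @ \oo --> (1 : R).
    rewrite -[X in _ --> X](subr0 1); apply: cvgB; first exact: cvg_cst.
    exact: (cvg_comp _ _ (cvg_truncn_infty (t0 e eE)) h).
  have h2 : (fun n => Num.min 1 (1 - (F e).2 (N n e))) @ \oo --> (1 : R).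
    by rewrite -[X in _ --> X]minxx; apply: cvg_minr h1; exact: cvg_cst.
  rewrite /f; have -> : (fun n => Num.max 0 (Num.min 1 (1 - (F e).2 (N n e)))) =
     fun n => - Num.min 0 (- Num.min 1 (1 - (F e).2 (N n e))).
    by apply/funext => n; rewrite oppr_min oppr0 opprK.
  rewrite -[X in _ --> X]opprK -[X in - X](_ : Num.min 0 (- 1) = _); last first.
    by rewrite min_r // oppr_le0.
  by apply: cvgN; apply: cvg_minr; [exact: cvg_cst|exact: cvgN h2].
- apply: cvg_bigmin; first exact/cvg_truncn/ltW.
  move=> e eE; have [_ _ h] := FP e eE; have [q0 _] := qE e eE.
  have -> : r = q e * t e by rewrite /t mulrC divfK // gt_eqF.
  exact: cvg_rate (t0 e eE) h.
Qed.

End Analysis.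

(** * Passage to the suprema and infinite values *)

Local Open Scope ereal_scope.

Lemma einv_ge0 (R : realType) (x : \bar R) : 0 <= x -> 0 <= einv x.
Proof.
rewrite /einv; case: eqP => // _; case: eqP => // _ x0.
by rewrite lee_fin invr_ge0 fine_ge0.
Qed.

(** The slack is measured in the reciprocal of the rate, which also covers an infinite supremum: its
    reciprocal is 0, and any achievable rate above 1/d will do. *)
Lemma ent_assist_approx (R : realType) (m : nat) (L : 'I_m -> finType) (rho : op R (Joint L)) i j (d : R) :
  0 < ent_assist rho i j -> (0 < d)%R ->
  exists q : R, [/\ (0 < q)%R, achievable (epr_protocol rho i j) q &
     (q^-1 < fine (einv (ent_assist rho i j)) + d)%R].
Proof.
set x := ent_assist rho i j => x0 d0.
set c := fine (einv x).
have c0 : (0 <= c)%R by rewrite fine_ge0 ?einv_ge0 // ltW.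
have cd0 : (0 < c + d)%R by rewrite ltr_wpDl.
have : ((c + d)^-1)%:E < x.
  move: x0 @c c0 cd0; rewrite /einv => x0; rewrite gt_eqF //.
  case: eqP => [-> _ _ /=|/eqP xoo c0 cd0]; first by rewrite ltry.
  have xf : x \is a fin_num by rewrite fin_numE xoo andbT -ltNye (lt_trans _ x0) // ltNyr.
  rewrite -[ltRHS](fineK xf) lte_fin /=.
  have f0 : (0 < fine x)%R by rewrite fine_gt0 // x0 ltey.
  by rewrite -[ltRHS]invrK ltf_pV2 ?posrE ?invr_gt0 // ltrDl.
rewrite {1}/x /ent_assist => /ereal_sup_gt[_ [q aq <-]]; rewrite lte_fin => ltq.
have q0 : (0 < q)%R by apply: lt_trans ltq; rewrite invr_gt0.
exists q; split=> //; by rewrite -[ltRHS]invrK ltf_pV2 ?posrE ?invr_gt0.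
Qed.

Theorem theorem4 (R : realType) (m : nat) (hm : (2 <= m)%N)
    (L : 'I_m -> finType) (rho : op R (Joint L)) :
  density rho ->
  (\big[Order.max/-oo%E]_(E : {set 'I_m * 'I_m} | is_spanning_tree E)
      tree_value rho E <= ghz_capacity rho)%E.
Proof.
move=> drho; have m0 : (0 < m)%N by apply: leq_trans hm.
have zero_ach (prot : nat -> nat -> R -> Prop) : (forall n, prot n 0%N 0%R) -> achievable prot 0%R.
  move=> h; exists (fun=> 0%N), (fun=> 0%R); split=> //; split; first exact: cvg_cst.
  under eq_fun => n do rewrite mul0r; exact: cvg_cst.
have D0 : 0 <= ghz_capacity rho.
  apply: ereal_sup_ubound; exists 0%R => //; apply: zero_ach => n.
  by have [] := trivial_protocols n m0 drho.
have E0 i j : 0 <= ent_assist rho i j.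
  apply: ereal_sup_ubound; exists 0%R => //; apply: zero_ach => n.
  by have [_] := trivial_protocols n m0 drho; apply.
apply: bigmax_le => [|E]; first exact: leNye.
move=> /and3P[_ /forallP conn _].
have {}conn u v : connect (adjE E) u v by have /forallP := conn u; apply.
rewrite /tree_value.
(* An edge of value 0 makes the sum infinite and the tree value 0, which [D0] bounds. *)
have [/existsP[e /andP[eE /eqP e0]]|] := boolP [exists e in E, ent_assist rho e.1 e.2 == 0].
  suff -> : \sum_(e in E) einv (ent_assist rho e.1 e.2) = +oo by rewrite /einv.
  apply/esum_eqyP => [i _|]; first by rewrite gt_eqF // (lt_le_trans _ (einv_ge0 (E0 _ _))) // ltNyr.
  by exists e; split; rewrite ?mem_index_enum // e0 /einv eqxx.
rewrite negb_exists => /forallP Epos.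
have {}Epos e : e \in E -> 0 < ent_assist rho e.1 e.2.
  by move=> eE; have := Epos e; rewrite eE /= lt_def E0 andbT.
pose c e := fine (einv (ent_assist rho e.1 e.2)).
have cE e : e \in E -> einv (ent_assist rho e.1 e.2) = (c e)%:E.
  move=> eE; rewrite /c fineK // /einv gt_eqF ?Epos //.
  by case: eqP.
rewrite (eq_bigr (fun e => (c e)%:E)) // sumEFin.
have c0 e : (0 <= c e)%R by rewrite fine_ge0 ?einv_ge0.
set s := (\sum_(e in E) c e)%R.
have s0 : (0 <= s)%R by rewrite sumr_ge0.
have ach r : (0 < r)%R -> (r * s < 1)%R -> r%:E <= ghz_capacity rho.
  move=> r0 rs; apply: ereal_sup_ubound; exists r => //.
  pose n := #|E|.
  (* The n edges together cost r * n * d = (1 - r s) n / (n + 1), which fits in the gap 1 - r s; the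
     successor keeps the denominator nonzero. *)
  pose d := ((1 - r * s) / (r * n.+1%:R))%R.
  have d0 : (0 < d)%R by rewrite divr_gt0 ?subr_gt0 ?mulr_gt0.
  have [q qP] : exists q : 'I_m * 'I_m -> R, forall e, e \in E ->
     [/\ (0 < q e)%R, achievable (epr_protocol rho e.1 e.2) (q e) & ((q e)^-1 < c e + d)%R].
    have ex e : exists x : R, e \in E ->
       [/\ (0 < x)%R, achievable (epr_protocol rho e.1 e.2) x & (x^-1 < c e + d)%R].
      case: (boolP (e \in E)) => [eE|_]; last by exists 0%R.
      by have [x xP] := ent_assist_approx (Epos e eE) d0; exists x.
    by exists (fun e => projT1 (cid (ex e))) => e; exact: (projT2 (cid (ex e))).
  apply: (tree_achievable (q := q) m0 drho conn) => //; first by move=> e /qP[].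
  apply: (@le_trans _ _ (r * \sum_(e in E) (c e + d)))%R.
    by rewrite ler_pM2l //; apply: ler_sum => e /qP[_ _ /ltW].
  rewrite big_split /= -/s sumr_const -/n -mulr_natl mulrDr.
  have -> : (r * (n%:R * d) = (1 - r * s) * (n%:R / n.+1%:R))%R.
    have := pnatr_eq0 R n.+1; rewrite /d /=; move: (n.+1%:R : R) => y /negbT y0.
    by field; rewrite y0 gt_eqF.
  rewrite -lerBrDl -[leRHS]mulr1 ler_pM2l ?subr_gt0 //.
  by rewrite ler_pdivrMr // mul1r ler_nat.
case D : (ghz_capacity rho) => [x| |]; last 2 first.
- by rewrite leey.
- by move: D0; rewrite D.
have x0 : (0 <= x)%R by move: D0; rewrite D lee_fin.
rewrite /einv; case: eqP => [[sE]|/eqP sN]; last first.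
  have sp : (0 < s)%R by rewrite lt_def s0 andbT; move: sN; rewrite eqe.
  case: eqP => //= _; rewrite lee_fin leNgt; apply/negP => xs.
  (* A rate strictly between the supposed capacity x and 1/s would be achievable by [ach]. *)
  pose r := ((x + s^-1) / 2)%R.
  have r1 : (x < r)%R by rewrite /r; lra.
  have r2 : (r < s^-1)%R by rewrite /r; lra.
  have := ach r (le_lt_trans x0 r1); rewrite D lee_fin leNgt r1 -ltr_pdivlMr // mul1r r2.
  by move=> /(_ isT).
(* When s = 0 every positive rate is achievable, so the capacity cannot be finite. *)
have := ach (x + 1)%R; rewrite sE mulr0 D lee_fin => /(_ _ ltr01).
by rewrite ltr_wpDl // => /(_ isT); rewrite gerDl ler10.
Qed.
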